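(* Let $\mu\in\mathbb R$, let $\phi:\mathbb Z^2\to\mathbb C$ be a discrete holomorphic function with edge-labelling $(m_{ij})$, and let $m\in\mathbb R\setminus\{0\}$ with $m\neq m_{ij}$ for all edges. Let $\Phi:\mathbb Z^2\to SL(2,\mathbb C)$ be a solution of $$\Phi_j=B_{ij}^{-1}\Phi_i,\qquad B_{ij}=\frac{1}{(\phi_i-\phi_j)\sqrt{m_{ij}}\sqrt{m_{ij}-m}}\begin{pmatrix} m_{ij}(\phi_i-\phi_j)-m\phi_i & m\phi_i\phi_j\\ -m & m_{ij}(\phi_i-\phi_j)+m\phi_j\end{pmatrix}$$ on all edges. Let $x:\mathbb Z^2\to\mathbb R^{3,1}$ be the discrete surface with Hermitian representative $$X=\Phi\begin{pmatrix}1&0\\0&-\mu\end{pmatrix}\Phi^\ast,\qquad\text{and let}\qquad G=\Big\langle\begin{pmatrix}|\phi|^2&\phi\\ \overline\phi&1\end{pmatrix}\Big\rangle .$$ Assume $x_i\not\perp G_i$ at all vertices. Then: (1) $x$ has constant discrete mean curvature $H=\frac1{\sqrt{|\mu|}}$ in the quadric $Q_\mu=\{v:(v,v)=\mu\}$ if $\mu\neq0$, and is intrinsically flat in the light cone $\mathcal L$ if $\mu=0$ (with respect to the lightlike Gauss map $G$). (2) Every discrete cmc $\frac1{\sqrt{|\mu|}}$ surface in $Q_\mu$ ($\mu\ne0$), respectively every discrete intrinsically flat surface in $\mathcal L$ ($\mu=0$), can locally be constructed in this way. (3) These Weierstrass-type representations can be viewed as certain applications of the $\Omega$-dual transformation to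 the prescribed discrete lightlike Gauss map $G$: the Legendre immersion $L=x+G$ is $\Omega$-dual to $G$.
   Context: **Minkowski space.** $\mathbb R^{3,1}$ is the real vector space with basis $e_0,e_1,e_2,e_3$ and product $(e_0,e_0)=-1$, $(e_n,e_n)=1$ ($n=1,2,3$), $(e_n,e_{n'})=0$ for $n\ne n'$. $\mathcal L=\{v:(v,v)=0\}$; $\mathbb P\mathcal L$ is the set of one-dimensional null subspaces; $\langle\cdot\rangle$ denotes linear span. In the Hermitian model $\mathbb R^{3,1}$ is the space of Hermitian $2\times2$ matrices with $(v,v)=-\det v$, where $e_0=\begin{pmatrix}1&0\\0&1\end{pmatrix}$, $e_1=\begin{pmatrix}0&1\\1&0\end{pmatrix}$, $e_2=\begin{pmatrix}0&\mathrm i\\-\mathrm i&0\end{pmatrix}$, $e_3=\begin{pmatrix}1&0\\0&-1\end{pmatrix}$; $B^\ast=\overline B^T$. **Discrete holomorphic.** $(ijkl)$ denotes an elementary quadrilateral (face) of $\mathbb Z^2$ with vertices in cyclic order. $\phi:\mathbb Z^2\to\mathbb C$ is discrete holomorphic if there is a real nowhere zero edge function $m_{ij}=m_{ji}$, equal on opposite edges of each face ($m_{ij}=m_{lk}$, $m_{il}=m_{jk}$), with $\frac{\phi_i-\phi_j}{\phi_j-\phi_k}\frac{\phi_k-\phi_l}{\phi_l-\phi_i}=\frac{m_{il}}{m_{ij}}<0$ on each face. The matrices $B_{ij}$ are determined up to sign; the (possibly imaginary) square roots are chosen independently of the direction of an edge and equal on opposite edges of a face. **Discrete surfaces.** A discrete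 surface is a map $x:\mathbb Z^2\to\mathbb R^{3,1}$; $dx_{ij}=x_i-x_j$ on edges, $\delta x_{ik}=x_i-x_k$ on diagonals. It is planar if each face is mapped to coplanar points, and circular if it is planar and for each face there is $c\in\mathbb R^{3,1}$ with $(x-c,x-c)$ equal at its four vertices. Two discrete surfaces $x,y$ are edge-parallel if $dx_{ij},dy_{ij}$ are parallel on every edge; for these the mixed area is $A(x,y)_{ijkl}=\frac14(\delta x_{ik}\wedge\delta y_{jl}-\delta x_{jl}\wedge\delta y_{ik})\in\Lambda^2\mathbb R^{3,1}$. Standing assumption: discrete surfaces for which curvatures are considered satisfy $A(x,x)\neq0$ on every face. A discrete Legendre immersion is a map $L$ from $\mathbb Z^2$ to the affine null lines of $\mathbb R^{3,1}$ with $L_i\cap L_j\ne\emptyset$ for every edge; it has the form $L=x+G$ with $x_i\in L_i$ and lightlike Gauss map $G:\mathbb Z^2\to\mathbb P\mathcal L$. $\Gamma L$, $\Gamma G$ denote sections (maps $y$ with $y_i\in L_i$, resp. nowhere zero $g$ with $\langle g_i\rangle=G_i$). Also assumed: on each face the four lines of $G$ span a space of dimension at least $3$. **Curvatures.** Let $x$ be a circular discrete surface and $L=x+G$ a discrete Legendre immersion with $x_i\not\perp G_i$. If $(x,x)=\mu\ne0$: let $g\in\Gamma G$ with $(g,x)=\mu$ and $n=(g-x)/\sqrt{|\mu|}$, so $(n,x)=0$ and $G=\langle x+\sqrt{|\mu|}\,n\rangle$; $n$ is edge-parallel to $x$, $G$ is called the hyperbolic Gauss map of $x$, and the discrete mean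 curvature $H$ is defined on faces by $A(x,n)+H A(x,x)=0$; $x$ is cmc $\frac1{\sqrt{|\mu|}}$ if $H\equiv\frac1{\sqrt{|\mu|}}$. If $(x,x)=0$: $x$ is intrinsically flat if $A(x,g)=0$ on all faces for some $g\in\Gamma G$ edge-parallel to $x$ (i.e. the light cone mean curvature $H_g$, defined by $A(x,g)+H_gA(x,x)=0$, vanishes). **$\Omega$-duality.** Two discrete surfaces are Christoffel dual if they are edge-parallel, circular, and have vanishing mixed area. A Legendre immersion $L$ with lightlike Gauss map $G$ is $\Omega$-dual to $G$ (equivalently: $L$ is discrete L-isothermic) if there are $y\in\Gamma L$ and $g\in\Gamma G$ which are Christoffel dual.
   Formalization: X carries signs ε_i=±1 with ε_iε_j=sgn(m_ij(m_ij−m)), since imaginary roots flip X; (2) holds on rectangles, up to an SL(2,C) motion if G meets φ=∞, where faces of G have negative cross-ratio and x_i is not ⊥ G_j on edges (both necessary). *)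

(* Defs.v *)
From HB Require Import structures.
From mathcomp Require Import all_boot all_order all_algebra.
From mathcomp Require Import reals.
From mathcomp Require Import complex.
From mathcomp Require Import ring.

Set Implicit Arguments.
Unset Strict Implicit.
Unset Printing Implicit Defensive.

Import Order.TTheory GRing.Theory Num.Theory.

Local Open Scope ring_scope.
Local Open Scope complex_scope.

Section Lattice.

Definition Z2 : Type := (int * int)%type.

Definition edge (i j : Z2) : bool := `|i.1 - j.1| + `|i.2 - j.2| == 1.

(* The elementary quadrilateral (ijkl) with lower left vertex i.  All face
   conditions below are insensitive to the choice of the first vertex and of
   the orientation of the cycle (up to inverting both sides of the cross-ratio
   equation and up to the sign of all mixed areas). *)
Definition vj (i : Z2) : Z2 := (i.1 + 1, i.2).
Definition vk (i : Z2) : Z2 := (i.1 + 1, i.2 + 1).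
Definition vl (i : Z2) : Z2 := (i.1, i.2 + 1).

Definition edge_in (D : pred Z2) (i j : Z2) : bool := [&& edge i j, D i & D j].

Definition face_in (D : pred Z2) (i : Z2) : bool :=
  [&& D i, D (vj i), D (vk i) & D (vl i)].

(* A possibly unbounded rectangle of the lattice. *)
Definition rect (I J : interval int) : pred Z2 :=
  fun i => (i.1 \in I) && (i.2 \in J).

End Lattice.

Section Minkowski.

Variable R : realType.

Definition mink (u v : 'rV[R]_4) : R :=
  - (u 0 0 * v 0 0) + u 0 1 * v 0 1 + u 0 2%:R * v 0 2%:R + u 0 3%:R * v 0 3%:R.

(* The bivector space is modelled by the skew-symmetric 4 x 4 matrices. *)
Definition wedge (u v : 'rV[R]_4) : 'M[R]_4 := u^T *m v - v^T *m u.

Definition null_line (V : {vspace 'rV[R]_4}) : Prop :=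
  \dim V = 1%N /\ forall v, v \in V -> mink v v = 0.

Definition perp (v : 'rV[R]_4) (V : {vspace 'rV[R]_4}) : Prop :=
  forall w, w \in V -> mink v w = 0.

Definition mx22 (T : Type) (a b c d : T) : 'M[T]_2 :=
  \matrix_(p < 2, q < 2)
    if p == 0 then (if q == 0 then a else b) else (if q == 0 then c else d).

Definition adj (A : 'M[R[i]]_2) : 'M[R[i]]_2 := (map_mx (@conjc R) A)^T.

(* v |-> v_0 e_0 + v_1 e_1 + v_2 e_2 + v_3 e_3 in the Hermitian model. *)
Definition herm (v : 'rV[R]_4) : 'M[R[i]]_2 :=
  mx22 (v 0 0 + v 0 3%:R)%:C (v 0 1 +i* v 0 2%:R)
       (v 0 1 -i* v 0 2%:R) (v 0 0 - v 0 3%:R)%:C.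

Definition unherm (A : 'M[R[i]]_2) : 'rV[R]_4 :=
  \row_(n < 4) nth 0 [:: (complex.Re (A 0 0) + complex.Re (A 1 1)) / 2;
                         complex.Re (A 0 1);
                         complex.Im (A 0 1);
                         (complex.Re (A 0 0) - complex.Re (A 1 1)) / 2] n.

Lemma hermK : cancel herm unherm.
Proof.
move=> v; apply/rowP => n; rewrite !mxE /=.
have vE (k l : 'I_4) : val k = val l -> v 0 l = v 0 k.
  by move=> kl; congr (v 0 _); apply: val_inj.
case: n => -[|[|[|[|//]]]] lt_n /=.
- by rewrite -(vE (Ordinal lt_n) 0) //; field.
- by rewrite -(vE (Ordinal lt_n) 1).
- by rewrite -(vE (Ordinal lt_n) 2%:R).
- by rewrite -(vE (Ordinal lt_n) 3%:R) //; field.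
Qed.

Lemma mink_herm (v : 'rV[R]_4) : (mink v v)%:C = - \det (herm v).
Proof.
rewrite (expand_det_row _ 0) !big_ord_recl big_ord0 /cofactor !det_mx11 !mxE /=.
rewrite /bump /= expr0 expr1 addr0 mul1r /mink.
by apply/eqP; rewrite eq_complex /=; apply/andP; split; apply/eqP; ring.
Qed.

(* The Lorentz transformation X |-> U X U^* induced by U in SL(2,C). *)
Definition lorentz (U : 'M[R[i]]_2) : 'End('rV[R]_4) :=
  linfun (fun v : 'rV[R]_4 => unherm (U *m herm v *m adj U)).

Lemma lorentzE U v : lorentz U v = unherm (U *m herm v *m adj U).
Proof.
have lin : linear (fun v : 'rV[R]_4 => unherm (U *m herm v *m adj U)).
  move=> a u w.
  have -> : herm (a *: u + w) = a%:C *: herm u + herm w.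
    apply/matrixP => p q; rewrite !mxE; case: (p == 0); case: (q == 0);
      by apply/eqP; rewrite eq_complex /=; apply/andP; split; apply/eqP; ring.
  rewrite mulmxDr mulmxDl -scalemxAr -scalemxAl.
  move: (U *m herm u *m adj U) (U *m herm w *m adj U) => A B.
  have ReE z z' : complex.Re (a%:C * z + z') = a * complex.Re z + complex.Re z'.
    by case: z z' => ? ? [? ?] /=; ring.
  have ImE z z' : complex.Im (a%:C * z + z') = a * complex.Im z + complex.Im z'.
    by case: z z' => ? ? [? ?] /=; ring.
  apply/rowP => n; rewrite !mxE.
  by case: n => -[|[|[|[|//]]]] lt_n; rewrite /= ?ReE ?ImE //; ring.
pose m := GRing.isLinear.Build R _ _ _ _ lin.
pose f : {linear _ -> _} := HB.pack (fun v : 'rV[R]_4 => _) m.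
by rewrite [LHS](lfunE f).
Qed.

End Minkowski.

Section Surfaces.

Variable R : realType.

Implicit Types (x y g n : Z2 -> 'rV[R]_4) (G : Z2 -> {vspace 'rV[R]_4}).

Definition planar x : Prop := forall i : Z2,
  (\dim <<[:: x (vj i) - x i; x (vk i) - x i; x (vl i) - x i]%R>> <= 2)%N.

Definition circular x : Prop :=
  planar x /\
  forall i : Z2, exists c : 'rV[R]_4, exists r : R,
    forall v : Z2, v \in [:: i; vj i; vk i; vl i] ->
      mink (x v - c) (x v - c) = r.

(* Parallelism of two (possibly zero) vectors is linear dependence. *)
Definition edge_parallel x y : Prop := forall i j : Z2, edge i j ->
  exists ab : R * R,
    ab != 0 /\ ab.1 *: (x i - x j) + ab.2 *: (y i - y j) = 0.

Definition mixed_area x y (i : Z2) : 'M[R]_4 :=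
  4^-1 *: (wedge (x i - x (vk i)) (y (vj i) - y (vl i))
         - wedge (x (vj i) - x (vl i)) (y i - y (vk i))).

Definition section_line x G y : Prop := forall i : Z2, y i - x i \in G i.

Definition section_gauss G g : Prop := forall i : Z2,
  g i != 0 /\ <[g i]>%VS = G i.

(* The affine null lines L_i = x_i + G_i form a discrete Legendre immersion. *)
Definition legendre x G : Prop :=
  [/\ forall i : Z2, null_line (G i),
      forall i j : Z2, edge i j ->
        exists p : 'rV[R]_4, p - x i \in G i /\ p - x j \in G j &
      forall i : Z2, (3 <= \dim (G i + G (vj i) + G (vk i) + G (vl i)))%N].

Definition surface_in_quadric (mu : R) x G : Prop :=
  [/\ forall i : Z2, mink (x i) (x i) = mu,
      circular x,
      legendre x G,
      forall i : Z2, ~ perp (x i) (G i) &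
      forall i : Z2, mixed_area x x i != 0].

Definition has_mean_curvature (mu : R) x G (H : Z2 -> R) : Prop :=
  exists g n, [/\ section_gauss G g,
    forall i : Z2, mink (g i) (x i) = mu,
    forall i : Z2, n i = (Num.sqrt `|mu|)^-1 *: (g i - x i),
    edge_parallel x n &
    forall i : Z2, mixed_area x n i + H i *: mixed_area x x i = 0].

Definition cmc (mu : R) x G : Prop :=
  [/\ mu != 0, surface_in_quadric mu x G &
      has_mean_curvature mu x G (fun=> (Num.sqrt `|mu|)^-1)].

Definition intrinsically_flat x G : Prop :=
  surface_in_quadric 0 x G /\
  exists g, [/\ section_gauss G g, edge_parallel x g &
    forall i : Z2, mixed_area x g i = 0].

Definition christoffel_dual x y : Prop :=
  [/\ edge_parallel x y, circular x, circular y &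
      forall i : Z2, mixed_area x y i = 0].

Definition omega_dual x G : Prop :=
  legendre x G /\
  exists y g, [/\ section_line x G y, section_gauss G g & christoffel_dual y g].

(* Conditions on a patch D under which the Weierstrass data of (x, G) exist
   on D up to a motion.
   - The spherical quadrilaterals of G are embedded: in the projectivised light
     cone the segments [G_i, G_k] and [G_j, G_l] meet.  For a stereographic
     coordinate phi of G this says that the (real) cross-ratio is negative.
   - x_i is not perpendicular to G_j on an edge (ij): if it were, the edge
     label determined by x and G would be m_ij = m. *)
Definition regular_on (D : pred Z2) x G : Prop :=
  (forall i : Z2, face_in D i ->
     exists gi gj gk gl : 'rV[R]_4,
       [/\ [/\ gi \in G i, gj \in G (vj i), gk \in G (vk i) & gl \in G (vl i)],
           [/\ 0 < gi 0 0, 0 < gj 0 0, 0 < gk 0 0 & 0 < gl 0 0] &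
           gi + gk = gj + gl]) /\
  (forall i j : Z2, edge_in D i j -> ~ perp (x i) (G j)).

End Surfaces.

Section Weierstrass.

Variable R : realType.

Definition edge_function (T : Type) (D : pred Z2) (w : Z2 -> Z2 -> T) : Prop :=
  (forall i j : Z2, edge_in D i j -> w i j = w j i) /\
  (forall i : Z2, face_in D i ->
     w i (vj i) = w (vl i) (vk i) /\ w i (vl i) = w (vj i) (vk i)).

Definition cross_ratio (a b c d : R[i]) : R[i] :=
  (a - b) / (b - c) * ((c - d) / (d - a)).

Definition discrete_holomorphic (D : pred Z2) (phi : Z2 -> R[i])
    (lab : Z2 -> Z2 -> R) : Prop :=
  [/\ edge_function D lab,
      forall i j : Z2, edge_in D i j -> lab i j != 0 &
      forall i : Z2, face_in D i ->
        cross_ratio (phi i) (phi (vj i)) (phi (vk i)) (phi (vl i))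
          = (lab i (vl i) / lab i (vj i))%:C /\
        lab i (vl i) / lab i (vj i) < 0].

(* s and r are the values of the square roots of m_ij and m_ij - m. *)
Definition Bmx (phi : Z2 -> R[i]) (lab : Z2 -> Z2 -> R) (m : R)
    (s r : Z2 -> Z2 -> R[i]) (i j : Z2) : 'M[R[i]]_2 :=
  ((phi i - phi j) * s i j * r i j)^-1 *:
  mx22 ((lab i j)%:C * (phi i - phi j) - m%:C * phi i) (m%:C * phi i * phi j)
       (- m%:C) ((lab i j)%:C * (phi i - phi j) + m%:C * phi j).

Definition Gmx (z : R[i]) : 'M[R[i]]_2 := mx22 (z * z^*) z z^* 1.

Definition Dmx (mu : R) : 'M[R[i]]_2 := mx22 1 0 0 (- mu%:C).

(* The signs eps account for the imaginary square roots: if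
   m_ij (m_ij - m) < 0 then s_ij r_ij is imaginary, conjugating B_ij changes
   its sign, and B_ij (.) B_ij^* is minus the transformation of R^{3,1} which
   relates x_i and x_j (without the correction L_i and L_j do not even meet).
   If m_ij (m_ij - m) > 0 on all edges then eps is constant, and eps = 1 is
   X = Phi diag(1, - mu) Phi^*. *)
Definition weierstrass_on (D : pred Z2) (mu : R) (phi : Z2 -> R[i])
    (lab : Z2 -> Z2 -> R) (m : R) (s r : Z2 -> Z2 -> R[i])
    (Phi : Z2 -> 'M[R[i]]_2) (eps : Z2 -> R)
    (x : Z2 -> 'rV[R]_4) (G : Z2 -> {vspace 'rV[R]_4}) : Prop :=
  [/\ discrete_holomorphic D phi lab /\
      (m != 0 /\ forall i j : Z2, edge_in D i j -> m != lab i j),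
      [/\ edge_function D s, edge_function D r &
          forall i j : Z2, edge_in D i j ->
            s i j ^+ 2 = (lab i j)%:C /\ r i j ^+ 2 = (lab i j - m)%:C],
      (forall i : Z2, D i -> \det (Phi i) = 1) /\
      (forall i j : Z2, edge_in D i j ->
         Phi j = invmx (Bmx phi lab m s r i j) *m Phi i),
      (forall i : Z2, D i -> eps i = 1 \/ eps i = -1) /\
      (forall i j : Z2, edge_in D i j ->
         eps i * eps j = Num.sg (lab i j * (lab i j - m))) &
      forall i : Z2, D i ->
        herm (x i) = (eps i)%:C *: (Phi i *m Dmx mu *m adj (Phi i)) /\
        G i = <[unherm (Gmx (phi i))]>%VS].

(* The null line which is not of the form <Gmx z>, i.e. phi = infinity. *)
Definition Ginfty : {vspace 'rV[R]_4} := <[unherm (mx22 1 0 0 0)%R]>%VS.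

End Weierstrass.

(* Main.v *)
Require Import Defs.
From mathcomp Require Import all_boot all_order all_algebra.
From mathcomp Require Import boolp classical_sets cardinality reals ereal.
From mathcomp Require Import measure lebesgue_measure complex ring lra zify.

(* A point z of C is identified with the null vector v v^*, v = (z, 1).  The
   matrix B_ij is diagonal in the basis v_i, v_j, so (up to a sign) it acts on
   R^{3,1} as the boost scaling G_i by 1 - m / m_ij and G_j by the inverse.
   With the section g of G normalised by (x, g) = 1, the relation between x_i
   and x_j becomes dx_ij = - (m / m_ij) dg_ij / (g_i, g_j), i.e. x is a
   Christoffel dual of g.

   A face has a negative real cross-ratio exactly if its four null lines have
   positive generators with Gamma_i + Gamma_k = Gamma_j + Gamma_l, and the
   cross-ratio is then - (Gamma_i, Gamma_j) / (Gamma_j, Gamma_k).  In terms of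
   these generators the four edges of x are
   dx_ij = nu (b_j Gamma_i - b_i Gamma_j), with b = (x, Gamma) and with factors
   nu, - nu, nu, - nu around the face; this makes non-corresponding diagonals
   of x and g parallel, hence the mixed area A(x, g) vanishes.  As n is a
   combination of x and g, this is the curvature condition.

   Conversely, for edge-parallel x and g the sum of the two wedge products of
   non-corresponding diagonals vanishes identically, so A(x, g) = 0 forces each
   of them to vanish, and the alternating pattern of the factors follows.  It
   determines edge labels with the required cross-ratios, and the matrices
   B_ij can be integrated over a rectangle. *)

Set Implicit Arguments.
Unset Strict Implicit.
Unset Printing Implicit Defensive.

Import Order.TTheory GRing.Theory Num.Theory.

Local Open Scope ring_scope.
Local Open Scope complex_scope.

(** * Polynomial consequences of equations *)

Section LinearCombination.

Variable A : comNzRingType.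
Implicit Types a b c d k l m n : A.

(** Certificates for identities that are combinations of given equations: the coefficients are
    supplied by hand and [ring] does the rest. *)
Lemma lincomb k c d a b : c = d -> a - b = k * (c - d) -> a = b.
Proof. by move=> ->; rewrite subrr mulr0 => /subr0_eq. Qed.

Lemma lincomb2 k l c d m n a b :
  c = d -> m = n -> a - b = k * (c - d) + l * (m - n) -> a = b.
Proof. by move=> -> ->; rewrite !subrr !mulr0 addr0 => /subr0_eq. Qed.

End LinearCombination.

Arguments lincomb {A} k [c d a b].
Arguments lincomb2 {A} k l [c d m n a b].

(** * The Minkowski product and bivectors *)

Section MinkowskiAlgebra.

Variable R : realType.
Implicit Types (u v w x y : 'rV[R]_4) (a b : R).

Lemma rV4_eqP u v : u 0 0 = v 0 0 -> u 0 1 = v 0 1 ->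
  u 0 2%:R = v 0 2%:R -> u 0 3%:R = v 0 3%:R -> u = v.
Proof.
move=> e0 e1 e2 e3; apply/rowP; case=> -[|[|[|[|//]]]] lt_n.
- by rewrite (_ : Ordinal lt_n = 0) //; apply: val_inj.
- by rewrite (_ : Ordinal lt_n = 1) //; apply: val_inj.
- by rewrite (_ : Ordinal lt_n = 2%:R) //; apply: val_inj.
- by rewrite (_ : Ordinal lt_n = 3%:R) //; apply: val_inj.
Qed.

Lemma minkC u v : mink u v = mink v u.
Proof. by rewrite /mink; ring. Qed.

Lemma minkDl u v w : mink (u + v) w = mink u w + mink v w.
Proof. by rewrite /mink !mxE; ring. Qed.

Lemma minkZl a u w : mink (a *: u) w = a * mink u w.
Proof. by rewrite /mink !mxE; ring. Qed.

Lemma minkNl u w : mink (- u) w = - mink u w.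
Proof. by rewrite /mink !mxE; ring. Qed.

Lemma minkBl u v w : mink (u - v) w = mink u w - mink v w.
Proof. by rewrite minkDl minkNl. Qed.

Lemma minkDr u v w : mink w (u + v) = mink w u + mink w v.
Proof. by rewrite minkC minkDl !(minkC w). Qed.

Lemma minkZr a u w : mink w (a *: u) = a * mink w u.
Proof. by rewrite minkC minkZl minkC. Qed.

Lemma minkNr u w : mink w (- u) = - mink w u.
Proof. by rewrite minkC minkNl minkC. Qed.

Lemma mink0l w : mink 0 w = 0.
Proof. by rewrite /mink !mxE; ring. Qed.

Lemma mink0r w : mink w 0 = 0.
Proof. by rewrite minkC mink0l. Qed.

Definition minkE := (minkDl, minkDr, minkZl, minkZr, minkNl, minkNr).

Lemma wedgeE u v p q : wedge u v p q = u 0 p * v 0 q - v 0 p * u 0 q.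
Proof. by rewrite !mxE !big_ord1 !mxE. Qed.

Lemma wedge_eq0P u v :
  wedge u v = 0 <-> forall p q, u 0 p * v 0 q = v 0 p * u 0 q.
Proof.
split=> [/matrixP uv0 p q|uv].
  by apply/subr0_eq; rewrite -wedgeE uv0 mxE.
by apply/matrixP => p q; rewrite wedgeE uv subrr mxE.
Qed.

Lemma wedgeNl u v : wedge (- u) v = - wedge u v.
Proof. by apply/matrixP => p q; rewrite [RHS]mxE !wedgeE !mxE; ring. Qed.

Lemma wedgeNr u v : wedge u (- v) = - wedge u v.
Proof. by apply/matrixP => p q; rewrite [RHS]mxE !wedgeE !mxE; ring. Qed.

Lemma wedgeZ a u : wedge u (a *: u) = 0.
Proof. by apply/wedge_eq0P => p q; rewrite !mxE; ring. Qed.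

Lemma wedge_parallel u v : u != 0 -> wedge u v = 0 -> exists a, v = a *: u.
Proof.
move=> /rV0Pn[p up0] /wedge_eq0P uv; exists (v 0 p / u 0 p).
by apply/rowP => q; rewrite !mxE mulrAC -uv mulrAC divff // mul1r.
Qed.

(** A nonzero [w] parallel to both [u] and [v] would make them parallel to each other. *)
Lemma wedge_both_eq0 u v w :
  wedge u v != 0 -> wedge u w = 0 -> wedge v w = 0 -> w = 0.
Proof.
move=> uv0 uw0 vw0.
have u0 : u != 0.
  by apply: contra_neq uv0 => ->; apply/wedge_eq0P => p q; rewrite !mxE; ring.
have [a wE] := wedge_parallel u0 uw0.
case: (eqVneq a 0) wE => [->|a0] wE; first by rewrite wE scale0r.
case/negP: uv0; apply/eqP/wedge_eq0P => p q; apply: (mulfI a0).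
by move/wedge_eq0P: vw0 => /(_ q p); rewrite wE !mxE => e; apply: (lincomb 1 e); ring.
Qed.

Lemma wedge_dependent x y (ab : R * R) :
  ab != 0 -> ab.1 *: x + ab.2 *: y = 0 -> wedge x y = 0.
Proof.
case: ab => a b ab0 /= /rowP rel; apply/wedge_eq0P => p q.
have ep := rel p; have er := rel q; rewrite !mxE in ep er.
have [a0|a0] := eqVneq a 0; last first.
  by apply: (mulfI a0); apply: (lincomb2 (y 0 q) (- y 0 p) ep er); ring.
have [b0|b0] := eqVneq b 0; last first.
  by apply: (mulfI b0); apply: (lincomb2 (- x 0 q) (x 0 p) ep er); ring.
by case/eqP: ab0; rewrite a0 b0.
Qed.

End MinkowskiAlgebra.

(** * Quadrilaterals *)

Section Quadrilateral.

Variable R : realType.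
Implicit Types (u v w : 'rV[R]_4) (a b c : R).

Variables xi xj xk xl Gi Gj Gk Gl : 'rV[R]_4.

Section Dual.

Variables nu bi bj bk bl : R.
Hypothesis nu0 : nu != 0.
Hypothesis rel : Gi + Gk = Gj + Gl.
Hypothesis rel0 : Gj + Gl != 0.
Hypothesis eij : xi - xj = nu *: (bj *: Gi - bi *: Gj).
Hypothesis ejk : xj - xk = - nu *: (bk *: Gj - bj *: Gk).
Hypothesis ekl : xk - xl = nu *: (bl *: Gk - bk *: Gl).
Hypothesis eli : xl - xi = - nu *: (bi *: Gl - bl *: Gi).

(** The four edges sum to zero around the face, and by [rel] their sum is [nu * (bj + bl - bi - bk)]
    times the nonzero vector [Gj + Gl]. *)
Lemma dual_weights : bi + bk = bj + bl.
Proof.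
have : (nu * (bj + bl - bi - bk)) *: (Gj + Gl) = 0.
  transitivity ((xi - xj) + (xj - xk) + (xk - xl) + (xl - xi)); last first.
    by apply/rowP => p; rewrite !mxE; ring.
  rewrite eij ejk ekl eli; apply/rowP => p.
  by move/rowP: rel => /(_ p); rewrite !mxE => e; apply: (lincomb (- nu * (bj + bl)) e); ring.
move/eqP; rewrite scaler_eq0 (negPf rel0) orbF mulf_eq0 (negPf nu0) /=.
by move/eqP => e; lra.
Qed.

(** For nonzero weights and g = G / b, the right-hand side is a multiple of [gl - gj]: a diagonal of
    x is parallel to the other diagonal of g. *)
Lemma dual_diagonal_ik : xi - xk = nu *: (bj *: Gl - bl *: Gj).
Proof.
rewrite -(subrKA xj) eij ejk; apply/rowP => p; have wt := dual_weights.
move/rowP: rel => /(_ p); rewrite !mxE => e.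
apply: (lincomb2 (nu * bj) (- nu * Gj 0 p) e wt); ring.
Qed.

Lemma dual_diagonal_jl : xj - xl = nu *: (bi *: Gk - bk *: Gi).
Proof.
rewrite -(subrKA xk) ejk ekl; apply/rowP => p; have wt := dual_weights.
move/rowP: rel => /(_ p); rewrite !mxE => e.
apply: (lincomb2 (nu * bk) (- nu * Gk 0 p) e wt); ring.
Qed.

End Dual.

Section Diagonals.

Variables yi yj yk yl : 'rV[R]_4.
Hypothesis pij : wedge (xi - xj) (yi - yj) = 0.
Hypothesis pjk : wedge (xj - xk) (yj - yk) = 0.
Hypothesis pkl : wedge (xk - xl) (yk - yl) = 0.
Hypothesis pli : wedge (xi - xl) (yi - yl) = 0.

(* Expanding (x_i - x_l) ^ (y_i - y_l) along the other three edges turns the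
   sum of the two mixed products into 0, whereas the mixed area is their
   difference. *)
Lemma diagonals_parallel :
  wedge (xi - xk) (yj - yl) - wedge (xj - xl) (yi - yk) = 0 ->
  wedge (xi - xk) (yj - yl) = 0 /\ wedge (xj - xl) (yi - yk) = 0.
Proof.
move=> A0.
have S0 : wedge (xi - xk) (yj - yl) + wedge (xj - xl) (yi - yk) = 0.
  apply/matrixP => p q; rewrite mxE !wedgeE.
  move/wedge_eq0P: pij => /(_ p q); move/wedge_eq0P: pjk => /(_ p q).
  move/wedge_eq0P: pkl => /(_ p q); move/wedge_eq0P: pli => /(_ p q).
  by rewrite !mxE; lra.
move: A0 S0; set U := wedge _ _; set V := wedge _ _ => /matrixP A0 /matrixP S0.
by split; apply/matrixP => p q; have := A0 p q; have := S0 p q;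
  rewrite !mxE; lra.
Qed.

Hypothesis A0 : wedge (xi - xk) (yj - yl) - wedge (xj - xl) (yi - yk) = 0.
Hypothesis ndx : wedge (xi - xk) (xj - xl) != 0.

(** As [xi = xj], the vector [yk - yl] is a difference of two vectors parallel to [xi - xk], and
    also of two vectors parallel to [xj - xl]. The diagonals of x are independent, so it
    vanishes. *)
Lemma collapsed_edge : xi = xj -> yk = yl.
Proof.
have [ik jl] := diagonals_parallel A0 => exy.
have ndx' := ndx; have pli' := pli; rewrite exy in ik jl ndx' pli'.
apply/eqP; rewrite -subr_eq0; apply/eqP.
apply: (wedge_both_eq0 ndx').
  move/wedge_eq0P: ik pjk => ik /wedge_eq0P pj; apply/wedge_eq0P => p q.
  by have := ik p q; have := pj p q; rewrite !mxE; lra.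
move/wedge_eq0P: jl pli' => jl /wedge_eq0P pl; apply/wedge_eq0P => p q.
by have := jl p q; have := pl p q; rewrite !mxE; lra.
Qed.

End Diagonals.

End Quadrilateral.

Section Labels.

Variable R : realType.
Implicit Types (u v w x G : 'rV[R]_4) (a b c : R).

Definition indep3 u v w : Prop :=
  forall a b c, a *: u + b *: v + c *: w = 0 -> [/\ a = 0, b = 0 & c = 0].

Lemma indep3_next Gi Gj Gk Gl :
  Gi + Gk = Gj + Gl -> indep3 Gi Gj Gk -> indep3 Gj Gk Gl.
Proof.
move=> rel ind a b c e.
have [|c0 ac0 bc0] := ind c (a - c) (b + c).
  rewrite -e; apply/rowP => p; move/rowP: rel => /(_ p); rewrite !mxE => e'.
  by apply: (lincomb c e'); ring.
by split; lra.
Qed.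

(** The diagonal [xi - xk] is a sum of two edges and also a multiple [t] of the vector in the last
    hypothesis. After [Gl] is replaced by [Gi + Gk - Gj], the coefficients of [Gi] and [Gk] give
    [n1 * bj = - t / bl] and [n2 * bj = t / bl]. *)
Lemma consecutive_labels xi xj xk Gi Gj Gk Gl bi bj bk bl n1 n2 :
  indep3 Gi Gj Gk -> Gi + Gk = Gj + Gl -> bj != 0 -> bl != 0 ->
  xi - xj = n1 *: (bj *: Gi - bi *: Gj) ->
  xj - xk = n2 *: (bk *: Gj - bj *: Gk) ->
  wedge (xi - xk) (bj^-1 *: Gj - bl^-1 *: Gl) = 0 -> n2 = - n1.
Proof.
move=> ind rel bj0 bl0 eij ejk par.
have relp p : Gl 0 p = Gi 0 p + Gk 0 p - Gj 0 p.
  by move/rowP: rel => /(_ p); rewrite !mxE => ->; ring.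
have [||t tE] := @wedge_parallel _ (bj^-1 *: Gj - bl^-1 *: Gl) (xi - xk).
- apply/eqP => e0; have [|/eqP] := ind (- bl^-1) (bj^-1 + bl^-1) (- bl^-1).
    rewrite -e0; apply/rowP => p; rewrite !mxE relp; ring.
  by rewrite oppr_eq0 invr_eq0 (negPf bl0).
- apply/wedge_eq0P => p q; move/wedge_eq0P: par => /(_ q p); lra.
have [|e1 _ e2] := ind (n1 * bj + t * bl^-1)
  (n2 * bk - n1 * bi - t * bl^-1 - t * bj^-1) (- n2 * bj + t * bl^-1).
  rewrite -(subrr (xi - xk)) {2}tE -[xi - xk](subrKA xj) eij ejk.
  by apply/rowP => p; rewrite !mxE relp; ring.
apply: (mulIf bj0); lra.
Qed.

End Labels.

(** * The Hermitian model *)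

Section HermitianModel.

Variable R : realType.
Local Notation C := R[i].
Local Notation cj := (@conjc R).
Implicit Types (u v w x y : 'rV[R]_4) (z : C).

Lemma conjcD z z' : cj (z + z') = cj z + cj z'. Proof. exact: rmorphD. Qed.
Lemma conjcB z z' : cj (z - z') = cj z - cj z'. Proof. exact: rmorphB. Qed.
Lemma conjcN z : cj (- z) = - cj z. Proof. exact: rmorphN. Qed.
Lemma conjcM z z' : cj (z * z') = cj z * cj z'. Proof. exact: rmorphM. Qed.
Lemma conjcV z : cj z^-1 = (cj z)^-1. Proof. exact: conjc_inv. Qed.

Definition conjE :=
  (conjcD, conjcN, conjcM, conjcV, @conjc1 R, @conjc0 R, @conjc_real R, @conjcK R).

Lemma mx22_eta (T : Type) (A : 'M[T]_2) :
  A = mx22 (A 0 0) (A 0 1) (A 1 0) (A 1 1).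
Proof.
apply/matrixP => p q; rewrite mxE.
by case: (fintype.split_ordP (p : 'I_(1 + 1))) => ? ->;
   case: (fintype.split_ordP (q : 'I_(1 + 1))) => ? ->;
   rewrite !ord1 /=; congr (A _ _); apply: val_inj.
Qed.

Lemma mulmx22 (a b c d a' b' c' d' : C) :
  mx22 a b c d *m mx22 a' b' c' d' =
  mx22 (a * a' + b * c') (a * b' + b * d') (c * a' + d * c') (c * b' + d * d').
Proof. by rewrite [LHS]mx22_eta !mxE !big_ord_recl !big_ord0 !mxE /= !addr0. Qed.

Lemma scalemx22 (k a b c d : C) :
  k *: mx22 a b c d = mx22 (k * a) (k * b) (k * c) (k * d).
Proof. by rewrite [LHS]mx22_eta !mxE. Qed.

Lemma addmx22 (a b c d a' b' c' d' : C) :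
  mx22 a b c d + mx22 a' b' c' d' = mx22 (a + a') (b + b') (c + c') (d + d').
Proof. by rewrite [LHS]mx22_eta !mxE. Qed.

Lemma adj_mx22 (a b c d : C) : adj (mx22 a b c d) = mx22 (cj a) (cj c) (cj b) (cj d).
Proof. by rewrite [LHS]mx22_eta !mxE. Qed.

Lemma det_mx22 (a b c d : C) : \det (mx22 a b c d) = a * d - b * c.
Proof.
rewrite (expand_det_row _ 0) !big_ord_recl big_ord0 /cofactor !det_mx11 !mxE /=.
by rewrite /bump /= expr0 expr1 addr0 mul1r mulN1r mulrN.
Qed.

Lemma scalar_mx22 (a : C) : a%:M = mx22 a 0 0 a.
Proof. by rewrite [LHS]mx22_eta !mxE. Qed.

Lemma cadjM (A B : 'M[C]_2) : adj (A *m B) = adj B *m adj A.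
Proof. by rewrite /adj map_mxM trmx_mul. Qed.

Lemma cadjZ k (A : 'M[C]_2) : adj (k *: A) = (cj k) *: adj A.
Proof. by rewrite [A]mx22_eta scalemx22 !adj_mx22 scalemx22 !rmorphM. Qed.

Lemma det_adj (A : 'M[C]_2) : \det (adj A) = (cj (\det A)).
Proof. by rewrite /adj det_tr det_map_mx. Qed.

Lemma herm_inj : injective (@herm R).
Proof. exact: can_inj (@hermK R). Qed.

Lemma hermD u v : herm (u + v) = herm u + herm v.
Proof.
rewrite /herm addmx22 !mxE; congr mx22;
  by apply/eqP; rewrite eq_complex /=; apply/andP; split; apply/eqP; ring.
Qed.

Lemma hermZ (a : R) u : herm (a *: u) = a%:C *: herm u.
Proof.
rewrite /herm scalemx22 !mxE; congr mx22;
  by apply/eqP; rewrite eq_complex /=; apply/andP; split; apply/eqP; ring.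
Qed.

Lemma herm0 : herm (0 : 'rV[R]_4) = 0.
Proof. by have := hermZ 0 0; rewrite !scale0r. Qed.

Lemma herm00J u : (cj (herm u 0 0)) = herm u 0 0.
Proof. by rewrite !mxE /= oppr0. Qed.

Lemma herm11J u : (cj (herm u 1 1)) = herm u 1 1.
Proof. by rewrite !mxE /= oppr0. Qed.

Lemma herm01J u : (cj (herm u 0 1)) = herm u 1 0.
Proof. by rewrite !mxE. Qed.

Lemma herm10J u : (cj (herm u 1 0)) = herm u 0 1.
Proof. by rewrite -herm01J conjcK. Qed.

Lemma herm_adj u : adj (herm u) = herm u.
Proof.
by rewrite [herm u]mx22_eta adj_mx22 herm00J herm11J herm01J herm10J.
Qed.

Lemma unhermK (A : 'M[C]_2) : adj A = A -> herm (unherm A) = A.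
Proof.
rewrite [A]mx22_eta adj_mx22 => /matrixP AE.
have := AE 0 0; have := AE 1 1; have := AE 1 0.
rewrite !mxE /=; case: (A 0 0) (A 0 1) (A 1 0) (A 1 1) => [a a'] [b b'] [c c'] [d d'].
move=> [<- <-] [d0] [a0]; rewrite /herm !mxE /=; congr mx22;
  by apply/eqP; rewrite eq_complex /=; apply/andP; split; apply/eqP; lra.
Qed.

(** Polarisation of (v, v) = - det v. *)
Lemma mink_hermE u v : (mink u v)%:C =
  - 2%:R^-1 * (herm u 0 0 * herm v 1 1 + herm u 1 1 * herm v 0 0
               - herm u 0 1 * herm v 1 0 - herm u 1 0 * herm v 0 1).
Proof.
apply: (mulfI (_ : 2%:R != 0 :> C)); first by rewrite pnatr_eq0.
rewrite mulrA mulrN divff ?pnatr_eq0 // mulN1r !mxE /mink /=.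
by apply/eqP; rewrite eq_complex /=; apply/andP; split; apply/eqP; ring.
Qed.

(** The Hermitian square v v^* of the spinor v = (a, b), a null vector. The pair is a homogeneous
    coordinate of its null line: a / b is the stereographic coordinate, and b = 0 is the point at
    infinity. *)
Definition spin (a b : C) : 'rV[R]_4 :=
  unherm (mx22 (a * (cj a)) (a * (cj b)) (b * (cj a)) (b * (cj b))).

Lemma herm_spin a b :
  herm (spin a b) = mx22 (a * (cj a)) (a * (cj b)) (b * (cj a)) (b * (cj b)).
Proof.
by apply: unhermK; rewrite adj_mx22 !rmorphM /= !conjcK; congr mx22; ring.
Qed.

Lemma unherm_Gmx z : unherm (Gmx z) = spin z 1.
Proof. by rewrite /spin /Gmx rmorph1 !mulr1 mul1r. Qed.

Lemma unherm_Ginfty : unherm (mx22 1 0 0 0) = spin 1 0.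
Proof. by rewrite /spin rmorph1 rmorph0 !mulr0 !mulr1. Qed.

Lemma mink_spin a b c d : (mink (spin a b) (spin c d))%:C =
  - 2%:R^-1 * ((a * d - b * c) * (cj (a * d - b * c))).
Proof. by rewrite mink_hermE !herm_spin !mxE /= rmorphB !rmorphM /=; ring. Qed.

Lemma complex_inj : injective (fun a : R => a%:C).
Proof. by move=> a b []. Qed.

Lemma mink_spin_null a b : mink (spin a b) (spin a b) = 0.
Proof. by apply: complex_inj; rewrite mink_spin [b * a]mulrC subrr mul0r mulr0. Qed.

Lemma mink_spin_le0 a b c d : mink (spin a b) (spin c d) <= 0.
Proof.
have := mink_spin a b c d; set z := _ - _.
case: z => p q /=; rewrite -(rmorph_nat (real_complex R)) -fmorphV /= => -[->].
nra.
Qed.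

Lemma mink_spin_eq0 a b c d :
  (mink (spin a b) (spin c d) == 0) = (a * d == b * c).
Proof.
rewrite -(inj_eq complex_inj) mink_spin mulf_eq0 oppr_eq0 invr_eq0 pnatr_eq0 /=.
by rewrite mulf_eq0 conjc_eq0 orbb subr_eq0.
Qed.

Definition nsq z : R := complex.Re z ^+ 2 + complex.Im z ^+ 2.

Lemma nsqE z : (nsq z)%:C = z * cj z.
Proof.
rewrite /nsq; case: z => p q; apply/eqP; rewrite eq_complex /=.
by apply/andP; split; apply/eqP; ring.
Qed.

Lemma nsq_gt0 z : (0 < nsq z) = (z != 0).
Proof.
case: z => p q; rewrite /nsq lt_neqAle addr_ge0 ?sqr_ge0 // andbT eq_sym.
by rewrite paddr_eq0 ?sqr_ge0 // !sqrf_eq0 eq_complex.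
Qed.

Lemma spinZ k a b : spin (k * a) (k * b) = nsq k *: spin a b.
Proof.
apply: herm_inj; rewrite hermZ nsqE !herm_spin scalemx22 !conjE.
by congr mx22; ring.
Qed.

Lemma spin_neq0 a b : ((a != 0) || (b != 0)) = (spin a b != 0).
Proof.
apply/idP/idP => [ab0|]; last first.
  apply: contraNT; rewrite negb_or !negbK => /andP[/eqP-> /eqP->].
  apply/eqP/herm_inj; rewrite herm_spin !mul0r herm0.
  by apply/matrixP => p q; rewrite !mxE; do !case: ifP.
apply/eqP => s0; case/orP: ab0 => /negP[].
  have := mink_spin_eq0 a b 0 1; rewrite s0 mink0l eqxx mulr1 mulr0 => <- //.
have := mink_spin_eq0 a b 1 0; rewrite s0 mink0l eqxx mulr1 mulr0 eq_sym => <- //.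
Qed.

End HermitianModel.

Section NullLines.

Variable R : realType.
Local Notation C := R[i].
Local Notation cj := (@conjc R).
Implicit Types (u v w x y : 'rV[R]_4) (z : C).

(** A nonzero Hermitian matrix of determinant 0 and positive trace has rank one; the spinor is its
    second column divided by the root [s] of the lower right entry. *)
Lemma null_spin u : mink u u = 0 -> 0 < u 0 0 -> exists a b, u = spin a b.
Proof.
move=> u0 u00; rewrite /mink in u0.
have AD : (herm u 0 0) * (herm u 1 1) = herm u 0 1 * herm u 1 0.
  have := mink_hermE u u; rewrite /mink u0 => /esym/eqP.
  rewrite mulf_eq0 oppr_eq0 invr_eq0 pnatr_eq0 /= => /eqP e.
  by apply: (mulfI (_ : 2%:R != 0 :> C)); [rewrite pnatr_eq0|apply: (lincomb 1 e); ring].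
have sqrtK (t : R) : 0 < t ->
    exists s : C, [/\ s * s = t%:C, s != 0 & (cj s) = s].
  move=> t0; exists (Num.sqrt t)%:C; rewrite conjc_real -rmorphM /= -expr2.
  rewrite sqr_sqrtr ?ltW //; split=> //; by rewrite fmorph_eq0 sqrtr_eq0 -ltNge.
have h11 : herm u 1 1 = (u 0 0 - u 0 3%:R)%:C by rewrite !mxE.
have h00 : herm u 0 0 = (u 0 0 + u 0 3%:R)%:C by rewrite !mxE.
have [D0|D0] := ltrP 0 (u 0 0 - u 0 3%:R).
  have [s [ss s0 sJ]] := sqrtK _ D0.
  exists (herm u 0 1 / s), s.
  apply: herm_inj; rewrite herm_spin [herm u in LHS]mx22_eta.
  rewrite conjcM conjcV sJ herm01J.
  rewrite -h11 in ss; congr mx22.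
  - apply: (mulIf s0); apply: (mulIf s0); rewrite -mulrA ss AD; field.
    exact: s0.
  - by field.
  - by field.
  - by rewrite ss.
(* The lower right entry is at most 0 here. As the trace is positive and the determinant 0, it
   vanishes together with the off-diagonal entries. *)
have [s [ss s0 sJ]] := sqrtK (u 0 0 + u 0 3%:R) ltac:(lra).
have D0' : u 0 0 - u 0 3%:R = 0 by nra.
have u1 : u 0 1 = 0 by nra.
have u2 : u 0 2%:R = 0 by nra.
exists s, 0; apply: herm_inj; rewrite herm_spin [herm u in LHS]mx22_eta.
by rewrite rmorph0 !mulr0 mul0r sJ ss h00 h11 D0' !mxE /= u1 u2 oppr0.
Qed.

End NullLines.

(** * Boosts and the matrices B_ij *)

Section Boost.

Variable R : realType.
Local Notation C := R[i].
Local Notation cj := (@conjc R).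
Implicit Types (u v w x y : 'rV[R]_4) (z : C) (l m : R).

Lemma hermN u : herm (- u) = - herm u.
Proof. by rewrite -scaleN1r hermZ rmorphN1 scaleN1r. Qed.

Lemma oppmx22 (a b c d : C) : - mx22 a b c d = mx22 (- a) (- b) (- c) (- d).
Proof. by rewrite [LHS]mx22_eta !mxE. Qed.

Lemma mx22E (T : Type) (a b c d : T) :
  (mx22 a b c d 0 0 = a) * (mx22 a b c d 0 1 = b) *
  (mx22 a b c d 1 0 = c) * (mx22 a b c d 1 1 = d).
Proof. by rewrite !mxE. Qed.

(* Scales the null line of [u] by [1 - m / l], that of [v] by the inverse, and
   fixes their orthogonal complement. *)
Definition boost l m u v y : 'rV[R]_4 :=
  y - (m / l * mink y v / mink u v) *: u
    + (m / (l - m) * mink y u / mink u v) *: v.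

Definition Bnum l m (a b : C) : 'M[C]_2 :=
  mx22 (l%:C * (a - b) - m%:C * a) (m%:C * a * b)
       (- m%:C) (l%:C * (a - b) + m%:C * b).

(** The spinors (a, 1) and (b, 1) are eigenvectors of [Bnum l m a b] with eigenvalues (a - b) (l -
    m) and (a - b) l. Their squared moduli, divided by the scalar on the right, are (l - m) / l and
    l / (l - m), the scalings of [boost]. *)
Lemma Bnum_boost l m a b y : a != b -> l != 0 -> l != m ->
  Bnum l m a b *m herm y *m adj (Bnum l m a b) =
  ((l * (l - m))%:C * ((a - b) * cj (a - b))) *:
    herm (boost l m (spin a 1) (spin b 1) y).
Proof.
move=> ab l0 lm.
have ab' : a - b != 0 by rewrite subr_eq0.
have cab' : cj a - cj b != 0 by rewrite -conjcB conjc_eq0.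
have l0' : l%:C != 0 by rewrite fmorph_eq0.
have lm' : l%:C - m%:C != 0 by rewrite -rmorphB fmorph_eq0 subr_eq0.
have uv : (mink (spin a 1) (spin b 1))%:C = - 2%:R^-1 * ((a - b) * cj (a - b)).
  by rewrite mink_spin mulr1 mul1r.
have yu (c : C) : (mink y (spin c 1))%:C = - 2%:R^-1 *
    (herm y 0 0 + herm y 1 1 * (c * cj c) - herm y 0 1 * cj c - herm y 1 0 * c).
  by rewrite mink_hermE herm_spin !mx22E !conjE; ring.
have c1 t : (m / l * t / mink (spin a 1) (spin b 1))%:C =
    m%:C / l%:C * t%:C / (- 2%:R^-1 * ((a - b) * cj (a - b))).
  by rewrite -uv !rmorphM !fmorphV.
have c2 t : (m / (l - m) * t / mink (spin a 1) (spin b 1))%:C =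
    m%:C / (l%:C - m%:C) * t%:C / (- 2%:R^-1 * ((a - b) * cj (a - b))).
  by rewrite -uv !rmorphM !fmorphV rmorphB.
have lE : (l * (l - m))%:C = l%:C * (l%:C - m%:C) by rewrite rmorphM rmorphB.
rewrite /boost /Bnum !hermD hermN !hermZ !herm_spin c1 c2 !yu lE.
rewrite [herm y]mx22_eta; move: (herm y 0 0) (herm y 0 1) (herm y 1 0) (herm y 1 1).
move=> h00 h01 h10 h11.
rewrite !mx22E adj_mx22 !mulmx22 !scalemx22 !oppmx22 !addmx22 !scalemx22 !conjE.
by congr mx22; field; rewrite ?l0' ?lm' ?ab' ?cab'.
Qed.

End Boost.

Section Transport.

Variable R : realType.
Local Notation C := R[i].
Local Notation cj := (@conjc R).
Implicit Types (u v w x y : 'rV[R]_4) (z : C) (l m : R).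

(** Pairing either relation with [u] gives [mink y u = (1 - m / l) * mink x u]. Trading [mink y u]
    for [mink x u] makes the edge equation antisymmetric in the two endpoints. *)
Lemma boost_edge l m u v x y :
  l != 0 -> l != m -> mink u u = 0 -> mink v v = 0 -> mink u v != 0 ->
  x = boost l m u v y <->
  x - y = - (m / l / mink u v) *: (mink y v *: u - mink x u *: v).
Proof.
move=> l0 lm uu vv uv0; have lm' : l - m != 0 by rewrite subr_eq0.
split=> [xE|dxE].
  have -> : mink x u = mink y u * (l / (l - m)).
    rewrite {1}xE /boost !minkE uu (minkC v u); field.
    by rewrite lm' uv0.
  rewrite xE /boost; apply/rowP => p; rewrite !mxE; field.
  by rewrite lm' uv0 l0.
have yu : mink y u = mink x u * ((l - m) / l).
  have : mink (x - y) u = m / l * mink x u.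
    rewrite dxE !minkE uu (minkC v u); field.
    by rewrite l0 uv0.
  rewrite !minkE => e; have -> : mink y u = mink x u - m / l * mink x u by rewrite -e; ring.
  by field.
apply/eqP; rewrite -(inj_eq (addIr (- y))); apply/eqP; rewrite dxE /boost yu.
apply/rowP => p; rewrite !mxE; field.
by rewrite l0 lm' uv0.
Qed.

(** A root of a real number is real or imaginary; the proof compares the squares of both sides. *)
Lemma sqr_conj (s : C) (a : R) : s ^+ 2 = a%:C -> s * cj s = `|a|%:C.
Proof.
move=> sa; have : (complex.Re s ^+ 2 + complex.Im s ^+ 2) ^+ 2 = a ^+ 2.
  case: s sa => p q /eqP; rewrite eq_complex /= => /andP[/eqP ra /eqP ia].
  by apply: (lincomb2 (p * p - q * q + a) (p * q + q * p) ra ia); ring.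
rewrite -[in RHS]real_normK ?num_real // => /(congr1 Num.sqrt).
rewrite !sqrtr_sqr normr_id ger0_norm ?addr_ge0 ?sqr_ge0 // => <-.
by case: s {sa} => p q; apply/eqP; rewrite eq_complex /=; apply/andP; split; apply/eqP; ring.
Qed.

Variables (phi : Z2 -> C) (lab : Z2 -> Z2 -> R) (m : R) (s r : Z2 -> Z2 -> C).

Local Notation gam i := (spin (phi i) 1).
Local Notation B := (Bmx phi lab m s r).

Lemma BmxE i j :
  B i j = ((phi i - phi j) * s i j * r i j)^-1 *: Bnum (lab i j) m (phi i) (phi j).
Proof. by []. Qed.

Variables i j : Z2.
Hypothesis phi_ij : phi i != phi j.
Hypothesis lab0 : lab i j != 0.
Hypothesis labm : lab i j != m.
Hypothesis sE : s i j ^+ 2 = (lab i j)%:C.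
Hypothesis rE : r i j ^+ 2 = (lab i j - m)%:C.

Let dphi0 : phi i - phi j != 0. Proof. by rewrite subr_eq0. Qed.

Lemma sqrt_label_neq0 : (s i j != 0) * (r i j != 0).
Proof.
by split; rewrite -sqrf_eq0 ?sE ?rE fmorph_eq0 ?subr_eq0.
Qed.

(** The numerator contributes the label times the label minus [m], the squared modulus of the two
    roots only its absolute value. The quotient is a sign, which the factors [eps] have to
    absorb. *)
Lemma Bmx_boost y : B i j *m herm y *m adj (B i j) =
  (Num.sg (lab i j * (lab i j - m)))%:C *:
    herm (boost (lab i j) m (gam i) (gam j) y).
Proof.
rewrite BmxE cadjZ -!scalemxAl -scalemxAr scalerA Bnum_boost // !scalerA.
congr (_ *: _); have lm : lab i j - m != 0 by rewrite subr_eq0.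
have [s0 r0] := sqrt_label_neq0.
have sgE (t : R) : t != 0 -> Num.sg t = t / `|t|.
  by move=> t0; rewrite {2}[t]numEsg mulfK ?normr_eq0.
rewrite sgE ?mulf_neq0 // normrM !rmorphM !fmorphV !rmorphM /=.
rewrite -(sqr_conj sE) -(sqr_conj rE) !conjE.
have cd0 : cj (phi i) - cj (phi j) != 0 by rewrite -conjcB conjc_eq0.
have cs0 : cj (s i j) != 0 by rewrite conjc_eq0.
have cr0 : cj (r i j) != 0 by rewrite conjc_eq0.
by field; rewrite s0 r0 cs0 cr0 dphi0 cd0.
Qed.

Lemma det_Bmx : \det (B i j) = 1.
Proof.
have [s0 r0] := sqrt_label_neq0.
rewrite BmxE detZ det_mx22.
have -> : (lab i j)%:C = s i j ^+ 2 by [].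
have -> : m%:C = s i j ^+ 2 - r i j ^+ 2.
  by rewrite sE rE rmorphB /=; ring.
by field; rewrite s0 r0 dphi0.
Qed.

Lemma Bmx_rev : lab i j = lab j i -> s i j = s j i -> r i j = r j i ->
  B i j *m B j i = 1%:M.
Proof.
move=> el es er; have [s0 r0] := sqrt_label_neq0.
rewrite !BmxE -scalemxAl -scalemxAr scalerA -el -es -er mulmx22 scalemx22.
have -> : (lab i j)%:C = s i j ^+ 2 by [].
have -> : m%:C = s i j ^+ 2 - r i j ^+ 2.
  by rewrite sE rE rmorphB /=; ring.
have dphi0' : phi j - phi i != 0 by rewrite -opprB oppr_eq0.
by rewrite scalar_mx22; congr mx22; field; rewrite s0 r0 dphi0 dphi0'.
Qed.

Lemma invmx_Bmx : lab i j = lab j i -> s i j = s j i -> r i j = r j i ->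
  invmx (B i j) = B j i.
Proof.
move=> el es er; rewrite -[LHS]mulmx1 -(Bmx_rev el es er) mulKmx //.
by rewrite unitmxE det_Bmx unitr1.
Qed.

End Transport.

(** * Cross-ratios *)

Section CrossRatio.

Variable R : realType.
Local Notation C := R[i].
Local Notation cj := (@conjc R).
Implicit Types (u v w x y : 'rV[R]_4).

(** The relation says Gi - Gj = Gl - Gk and Gi - Gl = Gj - Gk. All vectors being null, the norms of
    these differences are minus twice the products. *)
Lemma gram_face (Gi Gj Gk Gl : 'rV[R]_4) :
  mink Gi Gi = 0 -> mink Gj Gj = 0 -> mink Gk Gk = 0 -> mink Gl Gl = 0 ->
  Gi + Gk = Gj + Gl ->
  mink Gk Gl = mink Gi Gj /\ mink Gi Gl = mink Gj Gk.
Proof.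
move=> ii jj kk ll rel.
have e u v : mink (u - v) (u - v) = mink u u - 2%:R * mink u v + mink v v.
  by rewrite !minkE (minkC v u); ring.
have ij : Gi - Gj = Gl - Gk.
  by apply/rowP => p; move/rowP: rel => /(_ p); rewrite !mxE => h; apply: (lincomb 1 h); ring.
have il : Gi - Gl = Gj - Gk.
  by apply/rowP => p; move/rowP: rel => /(_ p); rewrite !mxE => h; apply: (lincomb 1 h); ring.
split; first by have := e Gi Gj; rewrite ij e (minkC Gl); lra.
by have := e Gi Gl; rewrite il e; lra.
Qed.

Lemma cross_ratio_neq0 (a b c d : C) : cross_ratio a b c d != 0 ->
  [/\ a != b, b != c, c != d & d != a].
Proof.
rewrite /cross_ratio !mulf_eq0 !invr_eq0 !subr_eq0 !negb_or.
by case/andP => /andP[-> ->] /andP[-> ->].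
Qed.

Lemma cross_ratioM (a b c d q : C) : cross_ratio a b c d = q -> q != 0 ->
  (a - b) * (c - d) = q * ((b - c) * (d - a)).
Proof.
move=> <- /cross_ratio_neq0[ab bc cd da]; rewrite /cross_ratio.
have bc' : b - c != 0 by rewrite subr_eq0.
have da' : d - a != 0 by rewrite subr_eq0.
by field; rewrite bc' da'.
Qed.

Lemma embedded_face (a b c d : C) (q : R) :
  cross_ratio a b c d = q%:C -> q < 0 ->
  exists t : R * R * R * R,
    [/\ 0 < t.1.1.1, 0 < t.1.1.2, 0 < t.1.2, 0 < t.2 &
        t.1.1.1 *: spin a 1 + t.1.2 *: spin c 1 =
        t.1.1.2 *: spin b 1 + t.2 *: spin d 1].
Proof.
move=> crE q0; have q0' : q%:C != 0 :> C by rewrite fmorph_eq0 lt_eqF.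
have crM := cross_ratioM crE q0'.
have [ab bc cd da] : [/\ a != b, b != c, c != d & d != a].
  by apply: cross_ratio_neq0; rewrite crE.
(* Equal opposite vertices would give the cross-ratio 1. *)
have ac : a != c.
  apply/eqP => ac; move: crM; rewrite -ac => e.
  have : (1 - q%:C) * ((a - b) * (a - d)) = 0 by apply: (lincomb 1 e); ring.
  move/eqP; rewrite !mulf_eq0 !subr_eq0 (negPf ab) -(eq_sym d) (negPf da) !orbF.
  by rewrite -(rmorph1 (real_complex R)) (inj_eq (@complex_inj R)) => /eqP; lra.
(* Let V_z = (z, 1), p = (b - c) V_a and r = (a - b) V_c.  Then
   p + r = (a - c) V_b and q p + r = w V_d; expanding both Hermitian squares
   and eliminating the mixed term gives the coefficients below. *)
pose w := (a - b) + q%:C * (b - c).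
have wd : w * d = (a - b) * c + q%:C * (b - c) * a.
  by rewrite /w; apply: (lincomb (- 1) crM); ring.
have w0 : w != 0.
  apply/eqP => w0; move: wd; rewrite w0 mul0r => /esym e.
  have : (a - b) * (c - a) = 0 by apply: (lincomb2 1 (- a) e w0); rewrite /w; ring.
  by move/eqP; rewrite mulf_eq0 !subr_eq0 (negPf ab) eq_sym (negPf ac).
exists (q * (q - 1) * nsq (b - c), - q * nsq (a - c), (1 - q) * nsq (a - b), nsq w).
split=> /=.
- by rewrite mulr_gt0 ?nsq_gt0 ?subr_eq0 //; nra.
- by rewrite mulr_gt0 ?nsq_gt0 ?subr_eq0 //; nra.
- by rewrite mulr_gt0 ?nsq_gt0 ?subr_eq0 //; nra.
- by rewrite nsq_gt0.
rewrite -spinZ wd mulr1; apply: herm_inj; rewrite !hermD !hermZ !herm_spin.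
rewrite !rmorphM !(rmorphN, rmorphB, rmorph1) /= !nsqE /w !scalemx22 !addmx22 !conjE.
by congr mx22; ring.
Qed.

Lemma cross_ratio_gram (a b c d : C) (ta tb tc td : R) :
  ta *: spin a 1 + tc *: spin c 1 = tb *: spin b 1 + td *: spin d 1 ->
  tb != 0 -> tc != 0 -> b != c -> d != a ->
  cross_ratio a b c d =
  (- (mink (tc *: spin c 1) (td *: spin d 1)
      / mink (tb *: spin b 1) (tc *: spin c 1)))%:C.
Proof.
move=> rel tb0 tc0 bc da.
have bc0 : b - c != 0 by rewrite subr_eq0.
have cbc0 : cj b - cj c != 0 by rewrite -conjcB conjc_eq0.
have da0 : d - a != 0 by rewrite subr_eq0.
have tb0' : tb%:C != 0 :> C by rewrite fmorph_eq0.
have tc0' : tc%:C != 0 :> C by rewrite fmorph_eq0.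
(* Multiplying the matrix relation by the row (1, - a) on the left kills the term of a, and by the
   column with entries 1 and - conj c on the right the term of c. Only b and d remain. *)
have key : tb%:C * (cj b - cj c) * (a - b) = - td%:C * (cj c - cj d) * (d - a).
  move: rel => /(congr1 (@herm R)); rewrite !hermD !hermZ !herm_spin.
  rewrite !scalemx22 !addmx22 !conjE => /matrixP rel.
  have e00 := rel 0 0; have e01 := rel 0 1; have e10 := rel 1 0; have e11 := rel 1 1.
  rewrite !mx22E in e00 e01 e10 e11.
  have e0 := congr2 (fun z z' : C => z - a * z') e00 e10.
  have e1 := congr2 (fun z z' : C => z - a * z') e01 e11.
  by rewrite /= in e0 e1; apply: (lincomb2 1 (- cj c) e0 e1); ring.
have key' : a - b = - td%:C * (cj c - cj d) * (d - a) / (tb%:C * (cj b - cj c)).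
  by rewrite -key; field; rewrite tb0' cbc0.
rewrite /cross_ratio key' rmorphN rmorphM fmorphV.
rewrite !minkE !rmorphM /= !mink_spin !mulr1 !mul1r !conjE.
by field; rewrite ?tb0' ?tc0' ?cbc0 ?bc0 ?da0.
Qed.

(** The rank-one matrix with image spanned by (a, 1) and kernel spanned by (b, 1); [Bnum l m a b] is
    l (a - b) times the identity plus m times this matrix. *)
Definition Bker (a b : C) : 'M[C]_2 := mx22 (- a) (a * b) (- 1) b.

(* The rank-one parts multiply to 0, since the image of the second is the
   kernel of the first. *)
Lemma Bnum_mul (l1 l2 m : R) (a b c : C) : a - b != 0 -> b - c != 0 ->
  ((a - b) * (b - c))^-1 *: (Bnum l1 m a b *m Bnum l2 m b c) =
  (l1%:C * l2%:C)%:M +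
  m%:C *: ((l2%:C / (a - b)) *: Bker a b + (l1%:C / (b - c)) *: Bker b c).
Proof.
move=> ab bc; rewrite /Bnum /Bker mulmx22 scalar_mx22 !scalemx22 !addmx22 !scalemx22 addmx22.
by congr mx22; field; rewrite ab bc.
Qed.

Variables (phi : Z2 -> C) (lab : Z2 -> Z2 -> R) (m : R) (s r : Z2 -> Z2 -> C).
Local Notation B := (Bmx phi lab m s r).

(** Both sides take the form of [Bnum_mul] with the same scalar part and the two labels trading
    places. The parts linear in [m] agree by the cross-ratio condition, solved for one label in
    [lE]. *)
Lemma Bmx_face i j k l :
  lab i j = lab l k -> lab i l = lab j k ->
  s i j = s l k -> s i l = s j k -> r i j = r l k -> r i l = r j k ->
  lab i j != 0 -> lab i l != 0 ->
  cross_ratio (phi i) (phi j) (phi k) (phi l) = (lab i l / lab i j)%:C ->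
  B i j *m B j k = B i l *m B l k.
Proof.
move=> l1 l2 s1 s2 r1 r2 l10 l20 crE.
have q0 : (lab i l / lab i j)%:C != 0 :> C by rewrite fmorph_eq0 mulf_neq0 ?invr_eq0.
have [ij jk kl li] : [/\ phi i != phi j, phi j != phi k, phi k != phi l & phi l != phi i].
  by apply: cross_ratio_neq0; rewrite crE.
have crM := cross_ratioM crE q0.
have l10' : (lab i j)%:C != 0 :> C by rewrite fmorph_eq0.
rewrite -subr_eq0 in ij; rewrite -subr_eq0 in jk.
rewrite -subr_eq0 in kl; rewrite -subr_eq0 in li.
have lE : (lab i l)%:C = (lab i j)%:C * ((phi i - phi j) * (phi k - phi l))
                       / ((phi j - phi k) * (phi l - phi i)).
  by rewrite crM rmorphM fmorphV /=; field; rewrite l10' jk li.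
have il : phi i - phi l != 0 by rewrite -opprB oppr_eq0.
have lk : phi l - phi k != 0 by rewrite -opprB oppr_eq0.
pose S := (s i j * r i j * (s i l * r i l))^-1.
have -> : B i j *m B j k = S *: (((phi i - phi j) * (phi j - phi k))^-1 *:
    (Bnum (lab i j) m (phi i) (phi j) *m Bnum (lab i l) m (phi j) (phi k))).
  rewrite !BmxE -!scalemxAl -!scalemxAr !scalerA -s2 -r2 -l2.
  by congr (_ *: _); rewrite /S !invfM; ring.
have -> : B i l *m B l k = S *: (((phi i - phi l) * (phi l - phi k))^-1 *:
    (Bnum (lab i l) m (phi i) (phi l) *m Bnum (lab i j) m (phi l) (phi k))).
  rewrite !BmxE -!scalemxAl -!scalemxAr !scalerA -s1 -r1 -l1.
  by congr (_ *: _); rewrite /S !invfM; ring.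
rewrite (Bnum_mul _ _ _ ij jk) (Bnum_mul _ _ _ il lk) [(lab i l)%:C * (lab i j)%:C]mulrC.
congr (_ *: (_ + _ *: _)); rewrite lE.
move: (phi i) (phi j) (phi k) (phi l) ij jk kl li il lk => a b c d ab bc cd da ad dc.
rewrite /Bker !scalemx22 !addmx22; by congr mx22; field; rewrite ?ab ?bc ?da ?ad ?dc.
Qed.

End CrossRatio.

(** * Spans of null vectors *)

Section Subspaces.

Variable R : realType.
Implicit Types (u v w : 'rV[R]_4).

Lemma vline_scale (k : R) u : k != 0 -> <[k *: u]>%VS = <[u]>%VS.
Proof.
move=> k0; apply/eqP; rewrite eqEsubv -!memvE memvZ ?memv_line //=.
by rewrite -{1}[u](scalerK k0) memvZ // memv_line.
Qed.

Lemma indep3P u v w : indep3 u v w <-> (3 <= \dim <<[:: u; v; w]>>)%N.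
Proof.
have -> : (3 <= \dim <<[:: u; v; w]>>)%N = free [:: u; v; w].
  by rewrite /free eqn_leq dim_span.
split=> [ind|fr a b c e].
  apply/freeP => /= k; rewrite !big_ord_recl big_ord0 addr0 addrA /= => e.
  have [e0 e1 e2] := ind _ _ _ e; case=> -[|[|[|//]]] lt_n.
  - by rewrite -e0; congr (k _); apply: val_inj.
  - by rewrite -e1; congr (k _); apply: val_inj.
  - by rewrite -e2; congr (k _); apply: val_inj.
have /freeP /= := fr => /(_ (fun i => [:: a; b; c]`_i)).
rewrite !big_ord_recl big_ord0 addr0 addrA /= => /(_ e) k0.
by split; [have := k0 ord0|have := k0 (lift ord0 ord0)|
  have := k0 (lift ord0 (lift ord0 ord0))].
Qed.

(** The Gram matrix has zero diagonal, so its determinant is twice the product of the three mutual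
    products. *)
Lemma null_indep3 u v w :
  mink u u = 0 -> mink v v = 0 -> mink w w = 0 ->
  mink u v != 0 -> mink u w != 0 -> mink v w != 0 -> indep3 u v w.
Proof.
move=> uu vv ww uv uw vw a b c e.
have eu : b * mink u v + c * mink u w = 0.
  by rewrite -(mink0r u) -e !minkE uu; ring.
have ev : a * mink u v + c * mink v w = 0.
  by rewrite -(mink0r v) -e !minkE vv (minkC v u); ring.
have ew : a * mink u w + b * mink v w = 0.
  by rewrite -(mink0r w) -e !minkE ww (minkC w u) (minkC w v); ring.
have c0 : c = 0.
  have : 2%:R * (mink u w * mink v w) * c = 0.
    transitivity (mink u w * (a * mink u v + c * mink v w)
      + mink v w * (b * mink u v + c * mink u w)
      - mink u v * (a * mink u w + b * mink v w)); first by ring.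
    by rewrite eu ev ew; ring.
  by move/eqP; rewrite !mulf_eq0 pnatr_eq0 (negPf uw) (negPf vw) => /eqP.
move: eu ev; rewrite c0 !mul0r !addr0 => /eqP; rewrite mulf_eq0 (negPf uv) orbF.
by move=> /eqP b0 /eqP; rewrite mulf_eq0 (negPf uv) orbF => /eqP a0.
Qed.

Lemma dim_span3 u v w a b : w = a *: u + b *: v ->
  (\dim <<[:: u; v; w]>> <= 2)%N.
Proof.
move=> ->; apply: leq_trans (_ : \dim <<[:: u; v]>> <= 2)%N; last exact: dim_span.
apply/dimvS/span_subvP => z; rewrite !inE => /or3P[] /eqP->.
- by apply: memv_span; rewrite mem_head.
- by apply: memv_span; rewrite inE mem_head orbT.
by rewrite memvD // memvZ // memv_span // !inE eqxx ?orbT.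
Qed.

End Subspaces.

(** * Edges of the lattice *)

Section Lattice.

Lemma edge_ind (P : Z2 -> Z2 -> Prop) :
  (forall i, P i (vj i)) -> (forall i, P i (vl i)) ->
  (forall i j, P i j -> P j i) -> forall i j, edge i j -> P i j.
Proof.
move=> Pj Pl Psym [a b] [c d] /eqP /= e.
have [|[|[]]] : (c = a + 1 /\ d = b) \/ (c = a /\ d = b + 1) \/
    (a = c + 1 /\ b = d) \/ (a = c /\ b = d + 1) by lia.
- by case=> -> ->; apply: (Pj (a, b)).
- by case=> -> ->; apply: (Pl (a, b)).
- by case=> -> ->; apply/Psym/(Pj (c, d)).
- by case=> -> ->; apply/Psym/(Pl (c, d)).
Qed.

Lemma edge_vj i : edge i (vj i).
Proof. by case: i => a b; rewrite /edge /=; lia. Qed.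

Lemma edge_vl i : edge i (vl i).
Proof. by case: i => a b; rewrite /edge /=; lia. Qed.

Lemma edge_jk i : edge (vj i) (vk i).
Proof. by case: i => a b; rewrite /edge /=; lia. Qed.

Lemma edge_lk i : edge (vl i) (vk i).
Proof. by case: i => a b; rewrite /edge /=; lia. Qed.

Lemma edgeC i j : edge i j = edge j i.
Proof. by rewrite /edge; lia. Qed.

End Lattice.

(** * From Weierstrass data to surfaces *)

Section Weierstrass.

Variable R : realType.
Local Notation C := R[i].

Lemma mixed_areaE (x y : Z2 -> 'rV[R]_4) i p q : mixed_area x y i p q =
  4^-1 * (wedge (x i - x (vk i)) (y (vj i) - y (vl i)) p q
         - wedge (x (vj i) - x (vl i)) (y i - y (vk i)) p q).
Proof. by rewrite !mxE. Qed.

Variables (mu : R) (phi : Z2 -> C) (lab : Z2 -> Z2 -> R) (m : R).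
Variables (s r : Z2 -> Z2 -> C) (Phi : Z2 -> 'M[C]_2) (eps : Z2 -> R).
Variables (x : Z2 -> 'rV[R]_4) (G : Z2 -> {vspace 'rV[R]_4}).
Hypothesis W : weierstrass_on predT mu phi lab m s r Phi eps x G.
Hypothesis xG : forall i, ~ perp (x i) (G i).

Local Notation gam i := (spin (phi i) 1).
Local Notation al i := (mink (x i) (gam i)).
Let g i := (al i)^-1 *: gam i.

Lemma edge_inT i j : edge i j -> edge_in predT i j.
Proof. by rewrite /edge_in => ->. Qed.

Lemma gauss_lineE i : G i = <[gam i]>%VS.
Proof. by case: W => _ _ _ _ /(_ i isT)[_ ->]; rewrite unherm_Gmx. Qed.

Lemma gam_neq0 i : gam i != 0.
Proof. by rewrite -spin_neq0 oner_eq0 orbT. Qed.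

Lemma al_neq0 i : al i != 0.
Proof.
apply/eqP => al0; apply: (xG (i := i)) => w; rewrite gauss_lineE => /vlineP[k ->].
by rewrite minkZr al0 mulr0.
Qed.

Lemma g_neq0 i : g i != 0.
Proof. by rewrite scaler_eq0 invr_eq0 (negPf (al_neq0 i)) (negPf (gam_neq0 i)). Qed.

Lemma g_line i : <[g i]>%VS = G i.
Proof. by rewrite vline_scale ?invr_eq0 ?al_neq0 // gauss_lineE. Qed.

Lemma mink_xg i : mink (x i) (g i) = 1.
Proof. by rewrite minkZr mulVf // al_neq0. Qed.

Lemma g_null i : mink (g i) (g i) = 0.
Proof. by rewrite !minkE mink_spin_null !mulr0. Qed.

Lemma x_quadric i : mink (x i) (x i) = mu.
Proof.
case: W => _ _ [/(_ i isT) dPhi _] [/(_ i isT) ei _] /(_ i isT)[xE _].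
apply: complex_inj; rewrite mink_herm xE detZ !det_mulmx det_adj dPhi.
rewrite conjc1 det_mx22 mulr1 mul1r mul0r subr0 mul1r mulrN opprK.
have : eps i ^+ 2 = 1 by case: ei => ->; rewrite ?sqrrN expr1n.
by move/(congr1 (real_complex R)); rewrite rmorphXn rmorph1 /= => ->; rewrite mul1r.
Qed.

Lemma face_cross_ratio i : lab i (vl i) / lab i (vj i) < 0 /\
  cross_ratio (phi i) (phi (vj i)) (phi (vk i)) (phi (vl i))
    = (lab i (vl i) / lab i (vj i))%:C.
Proof. by case: W => -[[_ _ /(_ i isT)[? ?]] _]. Qed.

Lemma face_phi_neq i : [/\ phi i != phi (vj i), phi (vj i) != phi (vk i),
  phi (vk i) != phi (vl i) & phi (vl i) != phi i].
Proof.
have [q0 crE] := face_cross_ratio i; apply: cross_ratio_neq0.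
by rewrite crE fmorph_eq0 lt_eqF.
Qed.

Lemma phi_neq i j : edge i j -> phi i != phi j.
Proof.
apply: (@edge_ind (fun i j => phi i != phi j)) => {i j} [i|i|i j].
- by case: (face_phi_neq i).
- by rewrite eq_sym; case: (face_phi_neq i).
- by rewrite eq_sym.
Qed.

Lemma lab_facts i j : edge i j ->
  [/\ lab i j = lab j i, lab i j != 0, lab i j != m &
      [/\ s i j ^+ 2 = (lab i j)%:C, r i j ^+ 2 = (lab i j - m)%:C,
          s i j = s j i & r i j = r j i]].
Proof.
move=> /edge_inT e; case: W => -[[[lC _] l0 _] [_ lm]] [[sC _] [rC _] sr] _ _ _.
have [sE rE] := sr _ _ e; split; [exact: lC|exact: l0| |split=> //].
- by rewrite eq_sym lm.
- exact: sC.
- exact: rC.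
Qed.

Lemma gam_mink_neq0 i j : phi i != phi j -> mink (gam i) (gam j) != 0.
Proof. by rewrite mink_spin_eq0 mulr1 mul1r. Qed.

(** The transport equation of the reversed edge reads Phi_i = B_ij Phi_j, so conjugation by B_ij
    relates the matrices of x_j and x_i. The sign in [Bmx_boost] is [eps i * eps j] and cancels. *)
Lemma x_boost i j : edge i j ->
  x i = boost (lab i j) m (gam i) (gam j) (x j).
Proof.
move=> e; have [lC l0 lm [sE rE sC rC]] := lab_facts e; have ij := phi_neq e.
have eC : edge j i by rewrite edgeC.
have [_ l0' lm' [sE' rE' _ _]] := lab_facts eC.
case: W => _ _ [_ /(_ j i (edge_inT eC))].
rewrite (invmx_Bmx _ l0' lm' sE' rE') // 1?eq_sym //.
move=> PhiE [ei /(_ i j (edge_inT e)) eE] xE.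
have [/(_ isT)[xi _] /(_ isT)[xj _]] := (xE i, xE j).
apply: herm_inj; have := Bmx_boost ij l0 lm sE rE (x j).
rewrite -eE xj -scalemxAr -scalemxAl !mulmxA -PhiE -!mulmxA -cadjM -PhiE => e1.
have sq k : (eps k)%:C * (eps k)%:C = 1.
  by rewrite -rmorphM /=; case: (ei k isT) => ->; rewrite ?mulrNN mulr1.
rewrite xi; move/(congr1 (fun A => ((eps i)%:C * (eps j)%:C) *: A)): e1.
rewrite !scalerA rmorphM -mulrA sq mulr1 mulmxA => ->.
by rewrite mulrACA !sq mul1r scale1r.
Qed.

Lemma dx_edge i j : edge i j -> x i - x j =
  - (m / lab i j / mink (gam i) (gam j)) *: (al j *: gam i - al i *: gam j).
Proof.
move=> e; have [_ l0 lm _] := lab_facts e.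
have uv := gam_mink_neq0 (phi_neq e).
by apply/(boost_edge _ _ l0 lm (mink_spin_null _ _) (mink_spin_null _ _) uv)/x_boost.
Qed.

Lemma m_neq0 : m != 0. Proof. by case: W => -[_ []]. Qed.

Definition kappa i j := - (m / lab i j / mink (gam i) (gam j)) * al i * al j.

Lemma kappa_neq0 i j : edge i j -> kappa i j != 0.
Proof.
move=> e; have [_ l0 _ _] := lab_facts e.
have uv := gam_mink_neq0 (phi_neq e).
by rewrite !mulf_eq0 oppr_eq0 !mulf_eq0 !invr_eq0 !negb_or m_neq0 l0 uv !al_neq0.
Qed.

Lemma dx_dg i j : edge i j -> x i - x j = kappa i j *: (g i - g j).
Proof.
move=> e; rewrite dx_edge // /kappa /g; apply/rowP => p; rewrite !mxE.
have := (al_neq0 i, al_neq0 j, gam_mink_neq0 (phi_neq e)).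
have [_ l0 _ _] := lab_facts e => -[[a1 a2] a3].
by field; rewrite l0 a1 a2 a3.
Qed.

(** The negative cross-ratio provides positive generators [t *: gam] with one linear relation. With
    weights (x, t gam) the edges of x satisfy the hypotheses of [dual_weights] and of the lemmas on
    the diagonals. *)
Lemma face_dual i : exists be : R * R * R * R,
  [/\ [/\ be.1.1.1 != 0, be.1.1.2 != 0, be.1.2 != 0 & be.2 != 0],
    be.1.1.1 + be.1.2 = be.1.1.2 + be.2,
    be.1.1.1 *: g i + be.1.2 *: g (vk i) = be.1.1.2 *: g (vj i) + be.2 *: g (vl i) &
    wedge (x i - x (vk i)) (g (vj i) - g (vl i)) = 0 /\
    wedge (x (vj i) - x (vl i)) (g i - g (vk i)) = 0].
Proof.
set j := vj i; set k := vk i; set l := vl i.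
have [q0 crE] := face_cross_ratio i; rewrite -/j -/k -/l in q0 crE.
have [ij jk kl li] := face_phi_neq i; rewrite -/j -/k -/l in ij jk kl li.
have [[[[ti tj] tk] tl] /= [ti0 tj0 tk0 tl0 rel]] := embedded_face crE q0.
have [ti1 tj1 tk1 tl1] : [/\ ti != 0, tj != 0, tk != 0 & tl != 0].
  by split; rewrite gt_eqF.
have eij : edge i j := edge_vj i.
have ejk : edge j k := edge_jk i.
have ekl : edge k l by rewrite edgeC; apply: edge_lk.
have eli : edge l i by rewrite edgeC; apply: edge_vl.
have cr2 := cross_ratio_gram rel tj1 tk1 jk li; rewrite crE in cr2.
have {}cr2 := complex_inj cr2.
set Gi := ti *: gam i in rel cr2; set Gj := tj *: gam j in rel cr2.
set Gk := tk *: gam k in rel cr2; set Gl := tl *: gam l in rel cr2.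
have nul t n : mink (t *: gam n) (t *: gam n) = 0.
  by rewrite !minkE mink_spin_null !mulr0.
have [gkl gil] := gram_face (nul ti i) (nul tj j) (nul tk k) (nul tl l) rel.
rewrite -/Gi -/Gj -/Gk -/Gl in gkl gil.
have [lij l0 _ _] := lab_facts eij; have [lil l0' _ _] := lab_facts eli.
have [lkl _ _ _] := lab_facts ekl.
case: (W) => -[[[_ /(_ i isT)[]]]]; rewrite -/j -/k -/l => l1 l2 _ _ _ _ _ _ _.
have gne a b n n' : a != 0 -> b != 0 -> phi n != phi n' ->
    mink (a *: gam n) (b *: gam n') != 0.
  by move=> a0 b0 nn; rewrite !minkE !mulf_neq0 // gam_mink_neq0.
have gij0 : mink Gi Gj != 0 by apply: gne.
have gjk0 : mink Gj Gk != 0 by apply: gne.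
have scaled a b n n' : edge n n' -> a != 0 -> b != 0 -> x n - x n' =
    - (m / lab n n' / mink (a *: gam n) (b *: gam n')) *:
      ((b * al n') *: (a *: gam n) - (a * al n) *: (b *: gam n')).
  move=> e a0 b0; rewrite dx_edge //; apply/rowP => p; rewrite !mxE !minkE.
  have [_ lab0 _ _] := lab_facts e.
  by field; rewrite (gam_mink_neq0 (phi_neq e)) lab0 a0 b0.
pose nu := - (m / lab i j / mink Gi Gj).
have nu0 : nu != 0 by rewrite oppr_eq0 !mulf_neq0 ?invr_eq0 ?m_neq0.
(* The label times the product of the generators changes sign from one edge to the next, so the
   factor [nu] alternates around the face. *)
have labE : lab i l = - lab i j * (mink Gi Gj / mink Gj Gk).
  by rewrite gkl in cr2; rewrite mulNr -mulrN -cr2 mulrC divfK.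
have nu' : - (m / lab i l / mink Gj Gk) = - nu.
  by rewrite labE /nu; field; rewrite gij0 gjk0 l0.
have dij := scaled _ _ _ _ eij ti1 tj1; rewrite -/Gi -/Gj -/nu in dij.
have djk := scaled _ _ _ _ ejk tj1 tk1; rewrite -/Gj -/Gk -l2 nu' in djk.
have dkl := scaled _ _ _ _ ekl tk1 tl1; rewrite -/Gk -/Gl lkl -l1 gkl -/nu in dkl.
have dli := scaled _ _ _ _ eli tl1 ti1.
rewrite -/Gi -/Gl lil (minkC Gl) gil nu' in dli.
(* The lower right entry of this sum is [tj + tl], which is positive. *)
have rel0 : Gj + Gl != 0.
  apply/eqP => /(congr1 (fun v => herm v 1 1)).
  rewrite herm0 hermD !hermZ !herm_spin !scalemx22 addmx22 mx22E mxE.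
  rewrite !conjE !mulr1 -rmorphD /= => /complex_inj e.
  by have := addr_gt0 tj0 tl0; rewrite e ltxx.
have wt := dual_weights nu0 rel rel0 dij djk dkl dli.
have dik := dual_diagonal_ik nu0 rel rel0 dij djk dkl dli.
have djl := dual_diagonal_jl nu0 rel rel0 dij djk dkl dli.
have GgE t n : t *: gam n = (t * al n) *: g n.
  by rewrite /g scalerA mulfK // al_neq0.
exists (ti * al i, tj * al j, tk * al k, tl * al l); split=> //=.
- by rewrite !mulf_neq0 ?al_neq0.
- by rewrite -!GgE.
rewrite /Gi /Gj /Gk /Gl !GgE in dik djl; rewrite dik djl.
by split; apply/wedge_eq0P => p q; rewrite !mxE; ring.
Qed.

Lemma g_parallel : edge_parallel x g.
Proof.
move=> i j e; exists (1, - kappa i j); split.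
  by rewrite xpair_eqE oner_eq0.
by rewrite /= dx_dg // scale1r scaleNr subrr.
Qed.

Lemma mixed_area_xg i : mixed_area x g i = 0.
Proof.
have [_ [_ _ _ [ik jl]]] := face_dual i.
by rewrite /mixed_area ik jl subrr scaler0.
Qed.

(** The weights on both sides of the relation in [face_dual] have the same sum, so it is an affine
    relation, to be solved for the last vertex. *)
Lemma g_planar : planar g.
Proof.
move=> i; have [[[[bi bj] bk] bl] /= [[_ _ _ bl0] wt rel _]] := face_dual i.
apply: (@dim_span3 _ _ _ _ (- (bj / bl)) (bk / bl)).
have bjE : bj = bi + bk - bl by rewrite wt addrK.
apply: (scalerI bl0); move: (g i) (g (vj i)) (g (vk i)) (g (vl i)) rel.
move=> gi gj gk gl rel; apply/rowP => p; move/rowP: rel => /(_ p).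
rewrite !mxE bjE => e; apply: (lincomb (- 1) e); field.
exact: bl0.
Qed.

Lemma x_planar : planar x.
Proof.
move=> i; apply: leq_trans (g_planar i); apply/dimvS/span_subvP => v.
set W' := <<_>>%VS.
have mem a b : edge a b -> g a - g i \in W' -> g b - g i \in W' -> x a - x b \in W'.
  move=> e ga gb; rewrite dx_dg // memvZ //.
  by rewrite -(subrKA (g i)) -[g i - g b]opprB memvB.
have gi : g i - g i \in W' by rewrite subrr mem0v.
have gj : g (vj i) - g i \in W' by rewrite memv_span // mem_head.
have gk : g (vk i) - g i \in W' by rewrite memv_span // !inE eqxx orbT.
have gl : g (vl i) - g i \in W' by rewrite memv_span // !inE eqxx !orbT.
have xj : x (vj i) - x i \in W'.
  by apply: mem => //; rewrite edgeC edge_vj.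
have xl : x (vl i) - x i \in W'.
  by apply: mem => //; rewrite edgeC edge_vl.
rewrite !inE => /or3P[] /eqP-> //.
rewrite -(subrKA (x (vj i))) memvD //.
by apply: mem => //; rewrite edgeC edge_jk.
Qed.

Lemma x_circular : circular x.
Proof.
by split; [exact: x_planar|move=> i; exists 0, mu => v _; rewrite subr0 x_quadric].
Qed.

Lemma g_circular : circular g.
Proof.
by split; [exact: g_planar|move=> i; exists 0, 0 => v _; rewrite subr0 g_null].
Qed.

Lemma xG_legendre : legendre x G.
Proof.
split=> [i|i j e|i].
- rewrite gauss_lineE; split; first by rewrite dim_vline gam_neq0.
  by move=> v /vlineP[k ->]; rewrite !minkE mink_spin_null !mulr0.
(* As dx = kappa dg, this point equals [x j - kappa i j *: g j] and lies on both lines. *)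
- exists (x i - kappa i j *: g i); rewrite -!g_line; split.
    by rewrite addrC addKr -scaleNr memvZ // memv_line.
  rewrite addrAC dx_dg // scalerBr addrAC subrr add0r -scaleNr memvZ //.
  exact: memv_line.
have [ij jk kl li] := face_phi_neq i; have [q0 crE] := face_cross_ratio i.
(* Equality would give the cross-ratio 1. With [ik], three of the four null lines are pairwise
   distinct, hence independent. *)
have ik : phi i != phi (vk i).
  apply/eqP => ik; move: q0.
  have /complex_inj <- : 1%:C = (lab i (vl i) / lab i (vj i))%:C.
    rewrite -crE /cross_ratio -ik rmorph1.
    rewrite -[phi (vj i) - _]opprB -[phi (vl i) - _]opprB.
    move: ij li; rewrite -subr_eq0 [in X in _ -> X -> _]eq_sym -[in X in _ -> X -> _]subr_eq0.
    by move=> ij li; field; rewrite ij li.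
  by rewrite ltr10.
have ind : indep3 (gam i) (gam (vj i)) (gam (vk i)).
  by apply: null_indep3; rewrite ?mink_spin_null ?gam_mink_neq0.
move/indep3P: ind => /leq_trans; apply; apply/dimvS/span_subvP => v.
rewrite !gauss_lineE !inE => /or3P[] /eqP->.
- exact: (subvP (subv_trans (addvSl _ _) (subv_trans (addvSl _ _) (addvSl _ _)))
            _ (memv_line _)).
- exact: (subvP (subv_trans (addvSr _ _) (subv_trans (addvSl _ _) (addvSl _ _)))
            _ (memv_line _)).
exact: (subvP (subv_trans (addvSr _ _) (addvSl _ _)) _ (memv_line _)).
Qed.

Lemma weierstrass_omega_dual : omega_dual x G.
Proof.
split; first exact: xG_legendre.
exists x, g; split.
- by move=> i; rewrite subrr mem0v.
- by move=> i; rewrite g_neq0 g_line.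
split; [exact: g_parallel|exact: x_circular|exact: g_circular|exact: mixed_area_xg].
Qed.

Hypothesis A0 : forall i, mixed_area x x i != 0.

Lemma weierstrass_in_quadric : surface_in_quadric mu x G.
Proof.
by split; [exact: x_quadric|exact: x_circular|exact: xG_legendre|exact: xG|exact: A0].
Qed.

(** For the section [mu *: g] the normal is n = t (mu g - x) with t = 1 / sqrt |mu|. So A(x, n) = t
    mu A(x, g) - t A(x, x), where the first term vanishes. *)
Lemma weierstrass_cmc : mu != 0 -> cmc mu x G.
Proof.
move=> mu0; split=> //; first exact: weierstrass_in_quadric.
exists (fun i => mu *: g i), (fun i => (Num.sqrt `|mu|)^-1 *: (mu *: g i - x i)).
set t := (Num.sqrt `|mu|)^-1; split=> //.
- by move=> i; rewrite scaler_eq0 (negPf mu0) (negPf (g_neq0 i)) vline_scale // g_line.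
- by move=> i; rewrite minkC minkZr mink_xg mulr1.
- move=> i j e; exists (t * (mu / kappa i j - 1), - 1).
  rewrite xpair_eqE oppr_eq0 oner_eq0 andbF; split=> //=.
  have k0 := kappa_neq0 e; move: (dx_dg e) k0.
  move: (g i) (g j) (kappa i j) => gi gj k dx k0.
  apply/rowP => p; move/rowP: dx => /(_ p); rewrite !mxE => dx.
  rewrite dx -[x i 0 p](subrK (x j 0 p)) dx; field; exact: k0.
move=> i; move: (mixed_area_xg i); move: (g : Z2 -> 'rV[R]_4) => g'.
move=> /matrixP A; apply/matrixP => p q; have := A p q.
rewrite [RHS]mxE mixed_areaE !wedgeE => e.
rewrite mxE [X in _ + X]mxE [RHS]mxE !mixed_areaE !wedgeE.
move: e; rewrite !mxE => e.
by apply: (lincomb (t * mu) e); ring.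
Qed.

Lemma weierstrass_flat : mu = 0 -> intrinsically_flat x G.
Proof.
move=> mu0; split; first by rewrite -mu0; exact: weierstrass_in_quadric.
exists g; split; [|exact: g_parallel|exact: mixed_area_xg].
by move=> i; rewrite g_neq0 g_line.
Qed.

End Weierstrass.

(** * From surfaces to Weierstrass data *)

Section Converse.

Variable R : realType.

(** The sign of [u 0 0] separates future from past null vectors; if this entry is 0, then so is
    [u]. *)
Lemma null_scaled_spin (u : 'rV[R]_4) :
  mink u u = 0 -> exists t a b, u = t *: spin a b.
Proof.
move=> uu; case: (ltrgtP (u 0 0) 0) => u0.
- have [||a [b e]] := @null_spin R (- u); rewrite ?minkE ?uu ?oppr0 ?mxE //; first by lra.
  by exists (- 1), a, b; rewrite -e scaleN1r opprK.
- by have [a [b ->]] := null_spin uu u0; exists 1, a, b; rewrite scale1r.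
exists 0, 0, 0; rewrite scale0r; rewrite /mink u0 in uu.
by apply: rV4_eqP; rewrite !mxE //; nra.
Qed.

Lemma null_orthogonal (u v : 'rV[R]_4) :
  mink u u = 0 -> mink v v = 0 -> mink u v = 0 -> wedge u v = 0.
Proof.
move=> /null_scaled_spin[t [a [b ->]]] /null_scaled_spin[t' [c [d ->]]].
rewrite !minkE => /eqP; rewrite !mulf_eq0 mink_spin_eq0.
have par (w : 'rV[R]_4) p q : wedge (p *: w) (q *: w) = 0.
  by apply/wedge_eq0P => ? ?; rewrite !mxE; ring.
case/or3P => [/eqP->|/eqP->|/eqP adbc].
- by rewrite scale0r -(scale0r (spin c d)) par.
- by rewrite scale0r -(scale0r (spin a b)) par.
have [a0|a0] := eqVneq a 0; last first.
  have -> : spin c d = nsq (c / a) *: spin a b.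
    by rewrite -spinZ divfK // mulrAC [c * b]mulrC -adbc mulrAC mulfV ?mul1r.
  by rewrite scalerA par.
have [b0|b0] := eqVneq b 0; last first.
  have -> : spin c d = nsq (d / b) *: spin a b.
    by rewrite -spinZ divfK // mulrAC [d * a]mulrC adbc mulrAC mulfV ?mul1r.
  by rewrite scalerA par.
have -> : spin a b = 0 *: spin c d.
  by apply/eqP; rewrite scale0r -[_ == _]negbK -spin_neq0 a0 b0 eqxx.
by rewrite scalerA par.
Qed.

Lemma future_null_le0 (u v : 'rV[R]_4) :
  mink u u = 0 -> mink v v = 0 -> 0 < u 0 0 -> 0 < v 0 0 -> mink u v <= 0.
Proof.
move=> uu vv u0 v0.
have [a [b ->]] := null_spin uu u0; have [c [d ->]] := null_spin vv v0.
exact: mink_spin_le0.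
Qed.

(** If [xi = xj], then [gk = gl] by [collapsed_edge], so [xk - xl] is a multiple of [gl]. As [xk]
    and [xl] have equal norms and [gl] is not orthogonal to [xl], the multiple is 0. Then the
    diagonals coincide, against their independence. *)
Lemma edge_distinct (xi xj xk xl gi gj gk gl : 'rV[R]_4) (a b : R) :
  wedge (xi - xj) (gi - gj) = 0 -> wedge (xj - xk) (gj - gk) = 0 ->
  wedge (xk - xl) (gk - gl) = 0 -> wedge (xi - xl) (gi - gl) = 0 ->
  wedge (xi - xk) (gj - gl) - wedge (xj - xl) (gi - gk) = 0 ->
  wedge (xi - xk) (xj - xl) != 0 ->
  xk - xl = a *: gk + b *: gl -> mink gl gl = 0 -> mink xl gl != 0 ->
  mink xk xk = mink xl xl -> xi != xj.
Proof.
move=> pij pjk pkl pli A0 ndx dkl gll xgl norms; apply/eqP => xij.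
have gkl := collapsed_edge pij pjk pkl pli A0 ndx xij.
rewrite gkl -scalerDl in dkl; move: (a + b) dkl => c dkl.
have c0 : c = 0.
  have xkE : xk = xl + c *: gl by rewrite -dkl addrC subrK.
  move: norms; rewrite xkE !minkE gll (minkC gl xl) => e.
  have /eqP : 2%:R * c * mink xl gl = 0 by apply: (lincomb 1 e); ring.
  by rewrite !mulf_eq0 pnatr_eq0 (negPf xgl) orbF => /eqP.
have xkl : xk = xl by apply/subr0_eq; rewrite dkl c0 scale0r.
by case/eqP: ndx; rewrite xij xkl -[X in wedge _ X]scale1r wedgeZ.
Qed.

(** With t = 1 / sqrt |mu| and n = t (g - x), parallelism passes from n to g, and the cmc equation
    becomes t A(x, g) = 0. *)
Lemma christoffel_gauss (mu : R) (x : Z2 -> 'rV[R]_4) (G : Z2 -> {vspace 'rV[R]_4}) :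
  (mu != 0 /\ cmc mu x G) \/ (mu = 0 /\ intrinsically_flat x G) ->
  surface_in_quadric mu x G /\ exists g, [/\ section_gauss G g,
    edge_parallel x g & forall i, mixed_area x g i = 0].
Proof.
case=> [[mu0 [_ Q [g [n [gG gx nE par H]]]]]|[-> [Q ?]]]; last by split.
split=> //; exists g; set t := (Num.sqrt `|mu|)^-1 in nE H.
have t0 : t != 0 by rewrite invr_eq0 sqrtr_eq0 -ltNge normr_gt0.
split=> // [i j e|i].
  have [[a b] [ab0 rel]] := par i j e; exists (a - b * t, b * t); split.
    apply: contra_neq ab0 => -[abt /eqP]; rewrite mulf_eq0 (negPf t0) orbF => /eqP b0.
    by move: abt; rewrite b0 mul0r subr0 => ->.
  by rewrite -rel !nE /=; apply/rowP => p; rewrite !mxE; ring.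
apply/matrixP => p q; move/matrixP: (H i) => /(_ p q) e.
rewrite mxE [X in _ + X = _]mxE [X in _ = X]mxE !mixed_areaE !wedgeE !nE !mxE in e.
rewrite mixed_areaE !wedgeE !mxE.
by apply: (mulfI t0); apply: (lincomb 1 e); ring.
Qed.

Section NormalizedGauss.

Variables (mu : R) (x : Z2 -> 'rV[R]_4) (G : Z2 -> {vspace 'rV[R]_4}).
Hypothesis Q : surface_in_quadric mu x G.
Variable g : Z2 -> 'rV[R]_4.
Hypothesis gG : section_gauss G g.
Hypothesis par : edge_parallel x g.
Hypothesis A0 : forall i, mixed_area x g i = 0.

Local Notation al i := (mink (x i) (g i)).

Let gi_null i : mink (g i) (g i) = 0.
Proof.
case: Q => _ _ [/(_ i)[_ nul] _ _] _ _; apply: nul.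
by have [_ <-] := gG i; apply: memv_line.
Qed.

Let al0 i : al i != 0.
Proof.
apply/eqP => al0; case: Q => _ _ _ /(_ i) nperp _; apply: nperp => w.
by have [_ <-] := gG i => /vlineP[k ->]; rewrite minkZr al0 mulr0.
Qed.

Let xx i : mink (x i) (x i) = mu.
Proof. by case: Q. Qed.

Let dwedge i j : edge i j -> wedge (x i - x j) (g i - g j) = 0.
Proof. by move=> /par[ab [ab0 rel]]; apply: wedge_dependent ab0 rel. Qed.

Let dx_span i j : edge i j -> exists a b, x i - x j = a *: g i + b *: g j.
Proof.
move=> e; case: Q => _ _ [_ /(_ i j e)[p [pi pj]] _] _ _.
move: pi pj; have [_ <-] := gG i; have [_ <-] := gG j.
move=> /vlineP[a pa] /vlineP[b pb]; exists (- a), b.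
by rewrite -pb scaleNr -pa; apply/rowP => q; rewrite !mxE; ring.
Qed.

Let area0 i :
  wedge (x i - x (vk i)) (g (vj i) - g (vl i))
  - wedge (x (vj i) - x (vl i)) (g i - g (vk i)) = 0.
Proof.
have /eqP := A0 i; rewrite /mixed_area scaler_eq0 invr_eq0 pnatr_eq0 /=.
by move/eqP.
Qed.

Let diag0 i : wedge (x i - x (vk i)) (x (vj i) - x (vl i)) != 0.
Proof.
case: Q => _ _ _ _ /(_ i); apply: contra_neq => /wedge_eq0P e.
apply/matrixP => p q; rewrite mixed_areaE !wedgeE !mxE.
by have := e p q; have := e q p; rewrite !mxE => e1 e2; lra.
Qed.

Let x_neq i j : edge i j -> x i != x j.
Proof.
apply: (@edge_ind (fun i j => x i != x j)) => {i j} [i|i|i j]; last first.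
- by rewrite eq_sym.
(* This edge comes first when the face is read in the opposite orientation, which only changes the
   sign of the mixed area. *)
- have [a [b e]] := dx_span (i := vk i) (j := vj i) ltac:(by rewrite edgeC edge_jk).
  apply: (edge_distinct _ _ _ _ _ _ e (gi_null _) (al0 _)); rewrite ?xx //.
  + exact/dwedge/edge_vl.
  + exact/dwedge/edge_lk.
  + by apply: dwedge; rewrite edgeC edge_jk.
  + exact/dwedge/edge_vj.
  + rewrite -[g (vl i) - _]opprB -[x (vl i) - _]opprB wedgeNr wedgeNl.
    by rewrite -opprD area0 oppr0.
  + by rewrite -[x (vl i) - _]opprB wedgeNr oppr_eq0 diag0.
have [a [b e]] := dx_span (i := vk i) (j := vl i) ltac:(by rewrite edgeC edge_lk).
apply: (edge_distinct _ _ _ _ _ _ e (gi_null _) (al0 _)); rewrite ?xx //.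
+ exact/dwedge/edge_vj.
+ exact/dwedge/edge_jk.
+ by apply: dwedge; rewrite edgeC edge_lk.
+ exact/dwedge/edge_vl.
Qed.

(** The lines of L meet, so dx = a g_i + b g_j. Equal norms give a (x_i, g_i) + b (x_j, g_j) = 0,
    and parallelism to dg gives b = - a. As the edge of x does not collapse, a is nonzero and the
    two values of (x, g) agree. *)
Let edge_facts i j : edge i j ->
  al i = al j /\ exists2 k, k != 0 & x i - x j = k *: (g i - g j) /\ mink (g i) (g j) != 0.
Proof.
move=> e; have dx0 : x i - x j != 0 by rewrite subr_eq0 x_neq.
have [a [b dx]] := dx_span e.
have xiE : x i = x j + (a *: g i + b *: g j) by rewrite -dx addrC subrK.
have rel : a * al i + b * al j = 0.
  have := xx i; rewrite -[RHS](xx j) => n.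
  have ei : mink (x i) (g i) = mink (x j) (g i) + b * mink (g i) (g j).
    by rewrite xiE !minkE gi_null (minkC (g j) (g i)); ring.
  have n' : mink (x i) (x i) = mink (x j) (x j)
      + 2%:R * (a * mink (x j) (g i) + b * mink (x j) (g j) + a * b * mink (g i) (g j)).
    rewrite {1 2}xiE !minkE !gi_null (minkC (g j) (g i)).
    by rewrite (minkC (g i) (x j)) (minkC (g j) (x j)); ring.
  rewrite n' in n; have := ei; rewrite mulrC => ei'.
  by move/eqP: n; rewrite -subr_eq0 => /eqP n; rewrite ei; lra.
(* Orthogonal null vectors are parallel, so dx would be a multiple of [g i], which vanishes by
   [rel]. *)
have gij0 : mink (g i) (g j) != 0.
  apply/eqP => gij0; have w0 := null_orthogonal (gi_null i) (gi_null j) gij0.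
  have gi0 : g i != 0 by have [] := gG i.
  have [t gjE] := wedge_parallel gi0 w0.
  case/eqP: dx0; rewrite dx gjE scalerA -scalerDl.
  suff -> : a + b * t = 0 by rewrite scale0r.
  apply: (mulIf (al0 i)); rewrite mul0r -[RHS]rel gjE minkZr.
  have -> : mink (x j) (g i) = al i; last by ring.
  by rewrite xiE !minkE gi_null gjE minkZl gi_null; ring.
have ba : b = - a.
  have /wedge_eq0P w := dwedge e.
  apply/eqP; rewrite -addr_eq0; apply: contraT => ab0; case/eqP: gij0.
  have : wedge (g i) (g j) = 0.
    apply/wedge_eq0P => p q; apply: (mulfI ab0).
    by have := w p q; rewrite dx !mxE; lra.
  have gi0 : g i != 0 by have [] := gG i.
  by case/(wedge_parallel gi0) => t ->; rewrite minkZr gi_null mulr0.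
have a0 : a != 0 by apply: contra_neq dx0 => a0; rewrite dx ba a0 oppr0 !scale0r addr0.
split; first by apply: (mulfI a0); move: rel; rewrite ba; lra.
by exists a => //; rewrite dx ba scaleNr scalerBr.
Qed.

(** Dividing by (x, g) keeps edges and diagonals of g parallel, because by [edge_facts] this number
    agrees at neighbouring vertices. *)
Lemma normalized_gauss : exists gh : Z2 -> 'rV[R]_4, [/\
  forall i, [/\ <[gh i]>%VS = G i, mink (x i) (gh i) = 1 & mink (gh i) (gh i) = 0],
  forall i j, edge i j ->
    exists2 k, k != 0 & x i - x j = k *: (gh i - gh j) /\ mink (gh i) (gh j) != 0 &
  forall i, wedge (x i - x (vk i)) (gh (vj i) - gh (vl i)) = 0 /\
            wedge (x (vj i) - x (vl i)) (gh i - gh (vk i)) = 0].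
Proof.
exists (fun i => (al i)^-1 *: g i); split=> [i|i j e|i].
- split; first by rewrite vline_scale ?invr_eq0 //; have [] := gG i.
    by rewrite minkZr mulVf.
  by rewrite !minkE gi_null !mulr0.
- have [alE [k k0 [dx gij]]] := edge_facts e.
  exists (k * al i); first by rewrite mulf_neq0.
  rewrite -alE -scalerBr scalerA mulfK // dx; split=> //.
  by rewrite !minkE !mulf_neq0 ?invr_eq0.
have [eij _] := edge_facts (edge_vj i); have [eil _] := edge_facts (edge_vl i).
have [ejk _] := edge_facts (edge_jk i).
rewrite -ejk -eil -eij -!scalerBr.
have zw (u v : 'rV[R]_4) c : wedge u v = 0 -> wedge u (c *: v) = 0.
  move=> /wedge_eq0P uv; apply/wedge_eq0P => p q.
  by have := uv p q; rewrite !mxE => uvpq; apply: (lincomb c uvpq); ring.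
have [ik jl] : wedge (x i - x (vk i)) (g (vj i) - g (vl i)) = 0 /\
               wedge (x (vj i) - x (vl i)) (g i - g (vk i)) = 0.
  apply: diagonals_parallel (area0 i); apply: dwedge.
  + exact: edge_vj.
  + exact: edge_jk.
  + by rewrite edgeC edge_lk.
  + exact: edge_vl.
by split; apply: zw.
Qed.

End NormalizedGauss.

End Converse.

(** * Edge labels of a Christoffel pair *)

Section EdgeLabels.

Variable R : realType.
Variables (x g : Z2 -> 'rV[R]_4) (G : Z2 -> {vspace 'rV[R]_4}) (D : pred Z2).
Hypothesis gG : forall i, [/\ <[g i]>%VS = G i, mink (x i) (g i) = 1 & mink (g i) (g i) = 0].
Hypothesis dxg : forall i j, edge i j ->
  exists2 k, k != 0 & x i - x j = k *: (g i - g j) /\ mink (g i) (g j) != 0.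
Hypothesis diag : forall i,
  wedge (x i - x (vk i)) (g (vj i) - g (vl i)) = 0 /\
  wedge (x (vj i) - x (vl i)) (g i - g (vk i)) = 0.
Hypothesis dimG : forall i, (3 <= \dim (G i + G (vj i) + G (vk i) + G (vl i)))%N.
Hypothesis reg : regular_on D x G.

(* With m = 1: the boost relating x_i and x_j scales G_i by
   (x_j, g_i) = 1 - m / m_ij. *)
Definition edge_label i j : R := (1 - mink (x j) (g i))^-1.

Lemma edge_labelE i j k : mink (g i) (g j) != 0 -> k != 0 ->
  x i - x j = k *: (g i - g j) -> edge_label i j = - (k * mink (g i) (g j))^-1.
Proof.
move=> gij k0 dx; have [_ xi gi] := gG i.
have : mink (x i - x j) (g i) = - (k * mink (g i) (g j)).
  by rewrite dx !minkE gi (minkC (g j)); ring.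
by rewrite minkBl xi /edge_label => ->; rewrite invrN.
Qed.

Lemma edge_label_sym i j : edge i j -> edge_label i j = edge_label j i.
Proof.
move=> e; have [k k0 [dx gij]] := dxg e.
have dx' : x j - x i = k *: (g j - g i) by rewrite -opprB dx -scalerN opprB.
rewrite (edge_labelE gij k0 dx); rewrite minkC in gij *.
by rewrite (edge_labelE gij k0 dx').
Qed.

Lemma edge_label_neq0 i j : edge i j -> edge_label i j != 0.
Proof.
move=> e; have [k k0 [dx gij]] := dxg e.
by rewrite (edge_labelE gij k0 dx) oppr_eq0 invr_eq0 mulf_neq0.
Qed.

(** Label 1 would mean (x_j, g_i) = 0, which regularity excludes on the reversed edge. *)
Lemma edge_label_neq1 i j : edge_in D i j -> edge_label i j != 1.
Proof.
move=> /and3P[e Di Dj]; apply/eqP => l1.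
case: reg => _ /(_ j i) []; first by rewrite /edge_in edgeC e Di Dj.
move=> w; have [<- _ _] := gG i => /vlineP[c ->]; rewrite minkZr.
have -> : mink (x j) (g i) = 0; last by rewrite mulr0.
have : (edge_label i j)^-1 = 1 by rewrite l1 invr1.
by rewrite invrK => ?; lra.
Qed.

Lemma dx_label i j : edge i j -> x i - x j =
  - (1 / edge_label i j / mink (g i) (g j)) *: (g i - g j).
Proof.
move=> e; have [k k0 [dx gij]] := dxg e.
rewrite (edge_labelE gij k0 dx) {1}dx; congr (_ *: _).
by field; rewrite k0 gij.
Qed.

(** The converse of [face_dual]. For generators t g the edge factors become k / (t t'), and the
    parallel diagonals force them to alternate. Each label is minus the inverse of such a factor
    times a product of generators, so [gram_face] gives equal opposite labels and their quotient. *)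
Lemma face_label i : face_in D i -> exists t : R * R * R * R,
  [/\ [/\ t.1.1.1 != 0, t.1.1.2 != 0, t.1.2 != 0 & t.2 != 0],
      t.1.1.1 *: g i + t.1.2 *: g (vk i) = t.1.1.2 *: g (vj i) + t.2 *: g (vl i),
      edge_label i (vj i) = edge_label (vl i) (vk i) /\
      edge_label i (vl i) = edge_label (vj i) (vk i),
      edge_label i (vl i) / edge_label i (vj i) =
        - (mink (t.1.2 *: g (vk i)) (t.2 *: g (vl i)) /
           mink (t.1.1.2 *: g (vj i)) (t.1.2 *: g (vk i))) &
      edge_label i (vl i) / edge_label i (vj i) < 0].
Proof.
move=> Di; have [/(_ i Di)[Gi [Gj [Gk [Gl [[mi mj mk ml] [pi pj pk pl] rel]]]]] _] := reg.
have mem n : forall v, v \in G n -> 0 < v 0 0 ->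
    exists2 t, t != 0 & v = t *: g n.
  move=> v; have [<- _ _] := gG n => /vlineP[t vE] v0; exists t => //.
  by apply: contraTneq v0 => t0; rewrite vE t0 scale0r mxE ltxx.
have [ti ti0 GiE] := mem _ _ mi pi; have [tj tj0 GjE] := mem _ _ mj pj.
have [tk tk0 GkE] := mem _ _ mk pk; have [tl tl0 GlE] := mem _ _ ml pl.
have nul n t : mink (t *: g n) (t *: g n) = 0.
  by have [_ _ gn] := gG n; rewrite !minkE gn !mulr0.
have [] : mink Gk Gl = mink Gi Gj /\ mink Gi Gl = mink Gj Gk.
  by apply: gram_face => //; rewrite ?GiE ?GjE ?GkE ?GlE nul.
move=> gkl gil; exists (ti, tj, tk, tl) => /=.
rewrite -GiE -GjE -GkE -GlE.
have [kij kij0 [dij gij0]] := dxg (edge_vj i).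
have [kjk kjk0 [djk gjk0]] := dxg (edge_jk i).
have elk : edge (vk i) (vl i) by rewrite edgeC edge_lk.
have eli : edge (vl i) i by rewrite edgeC edge_vl.
have [kkl kkl0 [dkl gkl0]] := dxg elk.
have [kli kli0 [dli gli0]] := dxg eli.
(* The relation puts [Gl] in the span of the other three, which thus contains all four lines and has
   dimension at least 3. *)
have ind : indep3 Gi Gj Gk.
  apply/indep3P; apply: leq_trans (dimG i) _; apply: dimvS.
  have Gmem n v t : t != 0 -> v = t *: g n -> (v \in <<[:: Gi; Gj; Gk]>>%VS) ->
      (G n <= <<[:: Gi; Gj; Gk]>>)%VS.
    move=> t0 vE vm; have [<- _ _] := gG n.
    by rewrite -memvE -[g n](scalerK t0) -vE memvZ.
  have m1 : Gi \in <<[:: Gi; Gj; Gk]>>%VS by rewrite memv_span // !inE eqxx.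
  have m2 : Gj \in <<[:: Gi; Gj; Gk]>>%VS by rewrite memv_span // !inE eqxx orbT.
  have m3 : Gk \in <<[:: Gi; Gj; Gk]>>%VS by rewrite memv_span // !inE eqxx !orbT.
  have m4 : Gl \in <<[:: Gi; Gj; Gk]>>%VS.
    have -> : Gl = Gi + Gk - Gj by rewrite rel addrC addKr.
    by rewrite memvB // memvD.
  rewrite !subv_add (Gmem _ _ _ ti0 GiE m1) (Gmem _ _ _ tj0 GjE m2).
  by rewrite (Gmem _ _ _ tk0 GkE m3) (Gmem _ _ _ tl0 GlE m4).
(* As (x, g) = 1, the weight of the generator [a *: g n] is [a] itself. *)
have scaled n n' a b k : a != 0 -> b != 0 -> x n - x n' = k *: (g n - g n') ->
    x n - x n' = (k / (a * b)) *: (b *: (a *: g n) - a *: (b *: g n')).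
  by move=> a0 b0 ->; apply/rowP => p; rewrite !mxE; field; rewrite a0 b0.
have scaledl n n' a b k : a != 0 -> b != 0 -> k != 0 -> mink (g n) (g n') != 0 ->
    x n - x n' = k *: (g n - g n') ->
    edge_label n n' = - (k / (a * b) * mink (a *: g n) (b *: g n'))^-1.
  move=> a0 b0 k0 gnn dx; rewrite (edge_labelE gnn k0 dx) !minkE.
  by congr (- _^-1); field; rewrite a0 b0.
have lij' := scaledl _ _ _ _ _ ti0 tj0 kij0 gij0 dij.
have ljk := scaledl _ _ _ _ _ tj0 tk0 kjk0 gjk0 djk.
have lkl' := scaledl _ _ _ _ _ tk0 tl0 kkl0 gkl0 dkl.
have lli' := scaledl _ _ _ _ _ tl0 ti0 kli0 gli0 dli.
rewrite -GiE -GjE in lij'; rewrite -GjE -GkE in ljk.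
rewrite -GkE -GlE in lkl'; rewrite -GlE -GiE in lli'.
have {}dij := scaled _ _ _ _ _ ti0 tj0 dij; have {}djk := scaled _ _ _ _ _ tj0 tk0 djk.
have {}dkl := scaled _ _ _ _ _ tk0 tl0 dkl; have {}dli := scaled _ _ _ _ _ tl0 ti0 dli.
rewrite -GiE -GjE -GkE -GlE in dij djk dkl dli.
have [ik jl] := diag i.
have gE t v n : t != 0 -> v = t *: g n -> t^-1 *: v = g n.
  by move=> t0 ->; rewrite scalerK.
have ki : wedge (x (vk i) - x i) (g (vl i) - g (vj i)) = 0.
  by rewrite -[x _ - _]opprB -[g _ - _]opprB wedgeNr wedgeNl opprK.
have rel' : Gj + Gl = Gk + Gi by rewrite -rel addrC.
have rel'' : Gk + Gi = Gl + Gj by rewrite -rel' addrC.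
have ind' := indep3_next rel ind; have ind'' := indep3_next rel' ind'.
(* The next three equations apply [consecutive_labels] at successive corners around the face. *)
have n1 : kjk / (tj * tk) = - (kij / (ti * tj)).
  apply: (consecutive_labels ind rel tj0 tl0 dij djk).
  by rewrite !(gE _ _ _ _ GjE, gE _ _ _ _ GlE).
have n2 : kkl / (tk * tl) = - (kjk / (tj * tk)).
  apply: (consecutive_labels ind' rel' tk0 ti0 djk dkl).
  rewrite (gE _ _ _ tk0 GkE) (gE _ _ _ ti0 GiE).
  by rewrite -[g (vk i) - _]opprB wedgeNr jl oppr0.
have n3 : kli / (tl * ti) = - (kkl / (tk * tl)).
  apply: (consecutive_labels ind'' rel'' tl0 tj0 dkl dli).
  by rewrite (gE _ _ _ tl0 GlE) (gE _ _ _ tj0 GjE).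
have lkl := edge_label_sym elk; have lli := edge_label_sym eli.
have nz : kij / (ti * tj) != 0 by rewrite !mulf_neq0 // invr_eq0 mulf_neq0.
have Gij0 : mink Gi Gj != 0 by rewrite GiE GjE !minkE !mulf_neq0.
have Gjk0 : mink Gj Gk != 0 by rewrite GjE GkE !minkE !mulf_neq0.
rewrite n2 n1 opprK in lkl' n3; rewrite n3 in lli'; rewrite n1 in ljk.
rewrite gkl in lkl'; rewrite minkC gil in lli'.
have lil : edge_label i (vl i) = (kij / (ti * tj) * mink Gj Gk)^-1.
  by rewrite -lli lli' mulNr invrN opprK.
split=> //.
- rewrite -lkl lkl' lij'; split=> //.
  by rewrite lil ljk mulNr invrN opprK.
- by rewrite lil lij' gkl; field; rewrite ?kij0 ?ti0 ?tj0 ?Gij0 ?Gjk0.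
rewrite lil lij'.
have -> : (kij / (ti * tj) * mink Gj Gk)^-1 / - (kij / (ti * tj) * mink Gi Gj)^-1
    = - (mink Gi Gj / mink Gj Gk) by field; rewrite ?kij0 ?ti0 ?tj0 ?Gij0 ?Gjk0.
(* Non-orthogonal future null vectors have a negative product, so quotients of such products are
   positive. *)
have le0 (u v : 'rV[R]_4) n n' a b : u = a *: g n -> v = b *: g n' ->
    0 < u 0 0 -> 0 < v 0 0 -> mink u v != 0 -> mink u v < 0.
  move=> uE vE u0 v0 uv; rewrite lt_neqAle uv future_null_le0 //.
    by rewrite uE nul.
  by rewrite vE nul.
have := le0 _ _ _ _ _ _ GiE GjE pi pj Gij0.
have := le0 _ _ _ _ _ _ GjE GkE pj pk Gjk0.
move=> jk ij; rewrite oppr_lt0 -mulrNN -invrN divr_gt0 // oppr_gt0 //.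
Qed.

End EdgeLabels.

(** * Integration over rectangles *)

Section Integration.

Lemma itv_convex (I : interval int) (a b c : int) :
  a \in I -> c \in I -> a <= b -> b <= c -> b \in I.
Proof. by case: I => [[[] l|[]] [[] u|[]]]; rewrite !in_itv //=; lia. Qed.

Lemma itv_ind (I : interval int) (P : int -> Prop) (o : int) :
  o \in I -> P o ->
  (forall a, a \in I -> a + 1 \in I -> P a <-> P (a + 1)) ->
  forall a, a \in I -> P a.
Proof.
move=> oI Po step.
have up (n : nat) : o + n%:Z \in I -> P (o + n%:Z).
  elim: n => [|n IH] nI; first by rewrite addr0.
  have nI' : o + n%:Z \in I by apply: (itv_convex oI nI); lia.
  have e : o + n.+1%:Z = o + n%:Z + 1 by lia.
  by rewrite e in nI *; apply: (step _ nI' nI).1; apply: IH.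
have down (n : nat) : o - n%:Z \in I -> P (o - n%:Z).
  elim: n => [|n IH] nI; first by rewrite subr0.
  have nI' : o - n%:Z \in I by apply: (itv_convex nI oI); lia.
  have e : o - n%:Z = o - n.+1%:Z + 1 by lia.
  by rewrite e in nI' IH; apply: (step _ nI nI').2; apply: IH.
move=> a aI; case: (leP o a) => oa.
  have e : a = o + (absz (a - o)%R)%:Z by lia.
  by rewrite e; apply: up; rewrite -e.
have e : a = o - (absz (a - o)%R)%:Z by lia.
by rewrite e; apply: down; rewrite -e.
Qed.

Fixpoint forward (T : Type) (up : int -> T -> T) (o : int) (f : T) (n : nat) : T :=
  if n is n'.+1 then up (o + n'%:Z) (forward up o f n') else f.

Fixpoint backward (T : Type) (down : int -> T -> T) (o : int) (f : T) (n : nat) : T :=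
  if n is n'.+1 then down (o - n%:Z) (backward down o f n') else f.

(** Recursion in both directions from [o]: [up a] passes from a to a + 1, and [down a] from a + 1
    back to a. *)
Definition along (T : Type) (up down : int -> T -> T) (o : int) (f : T) (a : int) : T :=
  if o <= a then forward up o f (absz (a - o)%R) else backward down o f (absz (a - o)%R).

Lemma along0 T up down (o : int) (f : T) : along up down o f o = f.
Proof. by rewrite /along lexx subrr. Qed.

Lemma along_up T up down (o a : int) (f : T) :
  o <= a -> along up down o f (a + 1) = up a (along up down o f a).
Proof.
move=> oa; rewrite /along oa ifT; last by lia.
have -> : absz (a + 1 - o)%R = (absz (a - o)%R).+1 by lia.
by rewrite /=; have -> : o + (absz (a - o)%R)%:Z = a by lia.
Qed.

Lemma along_down T up down (o a : int) (f : T) :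
  a < o -> along up down o f a = down a (along up down o f (a + 1)).
Proof.
move=> ao; rewrite /along ifF; last by lia.
have -> : absz (a - o)%R = (absz (a + 1 - o)%R).+1 by lia.
rewrite /=; have -> : o - ((absz (a + 1 - o)%R).+1)%:Z = a by lia.
case: ifP => // oa1; have -> : a + 1 = o by lia.
by rewrite subrr.
Qed.

(** F is built along the row of [o], and from there along each column. The vertical equations hold
    by construction; the horizontal ones spread from the row of [o] to all rows by the face
    condition. *)
Lemma rect_integrate (T : Type) (I J : interval int) (o : Z2)
    (t : Z2 -> Z2 -> T -> T) (f0 : T) :
  rect I J o ->
  (forall i j f, edge_in (rect I J) i j -> t j i (t i j f) = f) ->
  (forall i f, face_in (rect I J) i ->
     t (vj i) (vk i) (t i (vj i) f) = t (vl i) (vk i) (t i (vl i) f)) ->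
  exists F : Z2 -> T, F o = f0 /\
    forall i j, edge_in (rect I J) i j -> F j = t i j (F i).
Proof.
move: o => [o1 o2] /andP[/= o1I o2J] t_inv t_face.
pose F1 := along (fun a => t (a, o2) (a + 1, o2)) (fun a => t (a + 1, o2) (a, o2)) o1 f0.
pose F2 a := along (fun b => t (a, b) (a, b + 1)) (fun b => t (a, b + 1) (a, b)) o2 (F1 a).
have inE a b : rect I J (a, b) = (a \in I) && (b \in J) by [].
have vert a b : a \in I -> b \in J -> b + 1 \in J ->
    F2 a (b + 1) = t (a, b) (a, b + 1) (F2 a b).
  move=> aI bJ b1J.
  have e : edge_in (rect I J) (a, b) (a, b + 1).
    by rewrite /edge_in !inE aI bJ b1J (edge_vl (a, b)).
  have e' : edge_in (rect I J) (a, b + 1) (a, b).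
    by rewrite /edge_in !inE aI bJ b1J edgeC (edge_vl (a, b)).
  case: (leP o2 b) => ob; first exact: along_up.
  by rewrite [in RHS]/F2 along_down // t_inv.
have hor b : b \in J -> forall a, a \in I -> a + 1 \in I ->
    F2 (a + 1) b = t (a, b) (a + 1, b) (F2 a b).
  move: b; apply: (itv_ind o2J) => [a aI a1I|b bJ b1J].
    rewrite /F2 !along0.
    have e' : edge_in (rect I J) (a + 1, o2) (a, o2).
      by rewrite /edge_in !inE aI a1I o2J edgeC (edge_vj (a, o2)).
    case: (leP o1 a) => oa; first exact: along_up.
    by rewrite [in RHS]/F1 along_down // t_inv.
  have face a : a \in I -> a + 1 \in I -> face_in (rect I J) (a, b).
    by move=> aI a1I; rewrite /face_in /vj /vk /vl !inE /= aI a1I bJ b1J.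
  split=> H a aI a1I; have /= fc f := t_face _ f (face a aI a1I);
    rewrite /vj /vk /vl /= in fc.
    by rewrite !vert // H // fc.
  (* Going down a row, the transport along the vertical edge at a + 1 is inverted. *)
  have e : edge_in (rect I J) (a + 1, b) (a + 1, b + 1).
    by rewrite /edge_in !inE a1I bJ b1J (edge_vl (a + 1, b)).
  have := H a aI a1I; rewrite !vert // -fc => /(congr1 (t (a + 1, b + 1) (a + 1, b))).
  by rewrite !t_inv.
exists (fun i => F2 i.1 i.2); split; first by rewrite /= /F2 along0 /F1 along0.
suff both i j : edge i j -> rect I J i -> rect I J j ->
    F2 j.1 j.2 = t i j (F2 i.1 i.2) /\ F2 i.1 i.2 = t j i (F2 j.1 j.2).
  by move=> i j /and3P[e Di Dj]; have [] := both i j e Di Dj.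
move: i j; apply: edge_ind => [[a b]|[a b]|i j IH Dj Di]; last first.
- by have [? ?] := IH Di Dj.
- move=> Di Dj; have [/andP[aI bJ] /andP[_ b1J]] := (Di, Dj).
  have e : F2 a (b + 1) = t (a, b) (a, b + 1) (F2 a b) by exact: vert.
  split=> //=; rewrite e t_inv // /edge_in (edge_vl (a, b)).
  by rewrite Di; exact: Dj.
move=> Di Dj; have [/andP[aI bJ] /andP[a1I _]] := (Di, Dj).
have e : F2 (a + 1) b = t (a, b) (a + 1, b) (F2 a b) by exact: hor.
split=> //=; rewrite e t_inv // /edge_in (edge_vj (a, b)).
by rewrite Di; exact: Dj.
Qed.

Lemma rect_ind (I J : interval int) (o : Z2) (P : Z2 -> Prop) :
  rect I J o -> P o ->
  (forall i j, edge_in (rect I J) i j -> P i -> P j) ->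
  forall i, rect I J i -> P i.
Proof.
move: o => [o1 o2] /andP[/= o1I o2J] Po step [a b] /andP[/= aI bJ].
have both i j : edge i j -> rect I J i -> rect I J j -> P i <-> P j.
  move=> e Di Dj; split; apply: step; rewrite /edge_in ?e ?Di ?Dj //.
  by rewrite edgeC e.
move: b bJ; apply: (itv_ind o2J) => [|b bJ b1J].
  move: a aI; apply: (itv_ind o1I) => // a aI a1I.
  by apply: (both (a, o2) (vj (a, o2))); rewrite ?edge_vj // /rect /= ?aI ?a1I.
by apply: (both (a, b) (vl (a, b))); rewrite ?edge_vl // /rect /= ?aI ?bJ.
Qed.

End Integration.

(** * Lorentz transformations and normal forms of Hermitian matrices *)

Section Lorentz.

Variable R : realType.
Local Notation C := R[i].
Local Notation cj := (@conjc R).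
Implicit Types (u v x : 'rV[R]_4) (U : 'M[C]_2).

Lemma herm_lorentz U v : herm (lorentz U v) = U *m herm v *m adj U.
Proof.
rewrite lorentzE unhermK // !cadjM herm_adj mulmxA.
by rewrite [U]mx22_eta !adj_mx22 !conjcK.
Qed.

Lemma mink_lorentz U u v : \det U = 1 ->
  mink (lorentz U u) (lorentz U v) = mink u v.
Proof.
move=> dU.
have q w : mink (lorentz U w) (lorentz U w) = mink w w.
  by apply: complex_inj; rewrite !mink_herm herm_lorentz !det_mulmx det_adj dU conjc1 mulr1 mul1r.
have := q (u + v); rewrite linearD !minkE !q.
by rewrite (minkC v) (minkC (lorentz U v)) => e; lra.
Qed.

Lemma lorentz_spin (p q c d a b : C) :
  lorentz (mx22 p q c d) (spin a b) = spin (p * a + q * b) (c * a + d * b).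
Proof.
apply: herm_inj; rewrite herm_lorentz !herm_spin adj_mx22 !mulmx22 !conjE.
by congr mx22; ring.
Qed.

(** Supplies the frame at the base point. The sign is needed for [mu <= 0], where a matrix of
    determinant - mu is semidefinite of either sign. *)
Definition represented mu (X : 'M[C]_2) : Prop :=
  exists Phi : 'M[C]_2, exists e : R, [/\ \det Phi = 1, e = 1 \/ e = -1, 0 < mu -> e = 1 &
    X = e%:C *: (Phi *m Dmx mu *m adj Phi)].

Lemma represented_conj mu (W X : 'M[C]_2) : \det W = 1 ->
  represented mu (W *m X *m adj W) -> represented mu X.
Proof.
move=> dW [Phi [e [dP e1 emu XE]]].
have uW : W \in unitmx by rewrite unitmxE dW unitr1.
have uW' : adj W \in unitmx by rewrite unitmxE det_adj dW conjc1 unitr1.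
exists (invmx W *m Phi), e; split=> //.
  by rewrite det_mulmx det_inv dW invr1 mul1r.
have adjI : adj (invmx W) = invmx (adj W).
  rewrite -[LHS](mulmxK uW') -cadjM mulmxV // scalar_mx22 adj_mx22 conjc1 conjc0.
  by rewrite -scalar_mx22 mul1mx.
have -> : X = invmx W *m (W *m X *m adj W) *m invmx (adj W).
  by rewrite -!mulmxA mulmxV // mulmx1 mulKmx.
by rewrite XE cadjM adjI -scalemxAr -scalemxAl !mulmxA.
Qed.

(** For positive [a] this is a triangular factorisation with the root of [a]. A negative [a] is
    reached through the negated matrix, and for [mu > 0] the sign is then absorbed into [Phi]. *)
Lemma represented_diag mu (a : R) (b : C) (d : R) :
  a%:C * d%:C - b * cj b = - mu%:C -> a != 0 ->
  represented mu (mx22 a%:C b (cj b) d%:C).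
Proof.
have pos a' b' d' : a'%:C * d'%:C - b' * cj b' = - mu%:C -> 0 < a' ->
    exists Phi : 'M[C]_2, \det Phi = 1 /\
      mx22 a'%:C b' (cj b') d'%:C = Phi *m Dmx mu *m adj Phi.
  move=> det0 a0; set s : C := (Num.sqrt a')%:C.
  have ss : s * s = a'%:C by rewrite -rmorphM /= -expr2 sqr_sqrtr // ltW.
  have s0 : s != 0 by rewrite fmorph_eq0 sqrtr_eq0 -ltNge.
  have sJ : cj s = s by apply: conjc_real.
  exists (mx22 s 0 (cj b' / s) s^-1); split.
    by rewrite det_mx22 mul0r subr0 mulfV.
  rewrite adj_mx22 !mulmx22 !conjE ?sJ; congr mx22.
  - by rewrite -ss; ring.
  - by field.
  - by field.
  - apply: (mulfI s0); apply: (mulfI s0); rewrite mulrA ss.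
    have -> : a'%:C * d'%:C = b' * cj b' - mu%:C by rewrite -det0; ring.
    by field.
move=> det0 a0; have [ap|am] := ltrP 0 a.
  by have [Phi [dP XE]] := pos _ _ _ det0 ap; exists Phi, 1; split=> //; [left|rewrite scale1r].
have det0' : (- a)%:C * (- d)%:C - (- b) * cj (- b) = - mu%:C.
  by rewrite -det0 conjcN !rmorphN; ring.
have [|Phi [dP XE]] := pos _ _ _ det0'; first by rewrite oppr_gt0 lt_neqAle a0.
have {}XE : mx22 a%:C b (cj b) d%:C = (- 1)%:C *: (Phi *m Dmx mu *m adj Phi).
  by rewrite -XE scalemx22 conjcN !rmorphN rmorph1; congr mx22; ring.
have [mup|mum] := ltrP 0 mu; last first.
  by exists Phi, (-1); split=> //; [right|rewrite ltNge mum].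
set w : C := (Num.sqrt mu)%:C.
have ww : w * w = mu%:C by rewrite -rmorphM /= -expr2 sqr_sqrtr // ltW.
have w0 : w != 0 by rewrite fmorph_eq0 sqrtr_eq0 -ltNge.
have wJ : cj w = w by apply: conjc_real.
(* For [mu > 0] the form diag(1, - mu) is indefinite; V has determinant 1 and exchanges its axes,
   which reverses the sign of the form. *)
pose V := mx22 0 w^-1 (- w) 0.
have VE : (- 1)%:C *: Dmx mu = V *m Dmx mu *m adj V.
  rewrite /V /Dmx adj_mx22 !mulmx22 scalemx22 !conjE ?wJ -ww rmorphN rmorph1.
  by congr mx22; field.
exists (Phi *m V), 1; split=> //; [|by left|].
  by rewrite det_mulmx dP det_mx22 mul1r mul0r mulrN mulVf // opprK add0r.
rewrite scale1r XE cadjM !mulmxA -(mulmxA _ V) -(mulmxA _ _ (adj V)) -VE.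
by rewrite -scalemxAr -scalemxAl.
Qed.

(** The upper left entry is made nonzero by exchanging the diagonal entries or, if both vanish, by a
    shear that creates the entry 2 |b|^2. *)
Lemma represented_herm mu x : mink x x = mu -> x != 0 -> represented mu (herm x).
Proof.
move=> xx x0.
have det0 : herm x 0 0 * herm x 1 1 - herm x 0 1 * herm x 1 0 = - mu%:C.
  by rewrite -xx mink_herm [herm x in RHS]mx22_eta det_mx22 opprK.
have X0 : mx22 (herm x 0 0) (herm x 0 1) (cj (herm x 0 1)) (herm x 1 1) != mx22 0 0 0 0.
  rewrite herm01J -mx22_eta; apply: contra_neq x0 => X0; apply: herm_inj.
  by rewrite X0 herm0 [RHS]mx22_eta !mxE.
rewrite [herm x]mx22_eta -!herm01J.
rewrite -herm01J in det0; move: (herm x 0 1) det0 X0 => b det0 X0.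
have [a aE] : exists a : R, herm x 0 0 = a%:C by rewrite mxE; eexists.
have [d dE] : exists d : R, herm x 1 1 = d%:C by rewrite mxE; eexists.
rewrite aE dE in det0 X0 *.
have [a0|a0] := eqVneq a 0; last exact: represented_diag.
have [d0|d0] := eqVneq d 0; last first.
  pose V : 'M[C]_2 := mx22 0 1 (- 1) 0.
  apply: (@represented_conj _ V).
    by rewrite det_mx22 mul0r mulrN1 opprK add0r.
  rewrite adj_mx22 !mulmx22 !conjE.
  rewrite (_ : mx22 _ _ _ _ = mx22 d%:C (- cj b) (cj (- cj b)) a%:C).
    by apply: represented_diag => //; rewrite -det0 !conjE; ring.
  by rewrite !conjE; congr mx22; ring.
have b0 : b != 0 by apply: contra_neq X0 => ->; rewrite a0 d0 conjc0.
pose V : 'M[C]_2 := mx22 1 b 0 1.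
apply: (@represented_conj _ V); first by rewrite det_mx22 mulr0 mulr1 subr0.
rewrite adj_mx22 !mulmx22 !conjE a0 d0 rmorph0.
rewrite (_ : mx22 _ _ _ _ = mx22 (2%:R * nsq b)%:C b (cj b) 0%:C).
  apply: represented_diag; last by rewrite mulf_neq0 ?pnatr_eq0 // gt_eqF // nsq_gt0.
  by rewrite -det0 a0 d0 rmorph0; ring.
by rewrite mulr_natl rmorphMn /= nsqE -mulr_natl; congr mx22; ring.
Qed.

(** The reals are uncountable: otherwise the unit interval would have Lebesgue measure 0. *)
Lemma countable_avoid (T : countType) (c : T -> R) : exists t, forall i, c i != t.
Proof.
apply: contrapT => /forallNP all.
have cR : countable [set: R].
  have -> : [set: R]%classic = range c.
    apply/seteqP; split=> // t _; have /existsNP[i /negP] := all t.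
    by rewrite negbK => /eqP <-; exists i.
  exact: sub_countable (card_image_le _ _) (countableP _).
have c01 : countable [set` `[0, 1]%R : interval R]%classic.
  exact: sub_countable (subset_card_le (@subsetT _ _)) cR.
have := countable_lebesgue_measure0 c01.
rewrite lebesgue_measure_itv /= lte_fin ltr01 -EFinB subr0 => /eqP.
by rewrite eqe oner_eq0.
Qed.

End Lorentz.

(** * Construction of the frame on a rectangle *)

Section Construction.

Variable R : realType.
Local Notation C := R[i].
Variables (mu : R) (x g : Z2 -> 'rV[R]_4) (G : Z2 -> {vspace 'rV[R]_4}).
Hypothesis xx : forall i, mink (x i) (x i) = mu.
Hypothesis gG : forall i, [/\ <[g i]>%VS = G i, mink (x i) (g i) = 1 & mink (g i) (g i) = 0].
Hypothesis dxg : forall i j, edge i j ->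
  exists2 k, k != 0 & x i - x j = k *: (g i - g j) /\ mink (g i) (g j) != 0.
Hypothesis diag : forall i,
  wedge (x i - x (vk i)) (g (vj i) - g (vl i)) = 0 /\
  wedge (x (vj i) - x (vl i)) (g i - g (vk i)) = 0.
Hypothesis dimG : forall i, (3 <= \dim (G i + G (vj i) + G (vk i) + G (vl i)))%N.

Variables (I J : interval int) (o : Z2).
Local Notation D := (rect I J).
Hypothesis Do : D o.
Hypothesis reg : regular_on D x G.

Variables (U : 'M[C]_2) (phi : Z2 -> C) (c : Z2 -> R).
Hypothesis dU : \det U = 1.
Hypothesis c0 : forall i, D i -> c i != 0.
Hypothesis gphi : forall i, D i -> lorentz U (g i) = c i *: spin (phi i) 1.

Local Notation lab := (edge_label x g).
Local Notation y i := (lorentz U (x i)).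
Local Notation gam i := (spin (phi i) 1).
Let s i j := sqrtc (lab i j)%:C.
Let r i j := sqrtc (lab i j - 1)%:C.
Local Notation B := (Bmx phi lab 1 s r).

Let gam_mink i j : D i -> D j -> c i * c j * mink (gam i) (gam j) = mink (g i) (g j).
Proof.
move=> Di Dj; by rewrite -[RHS](mink_lorentz _ _ dU) !gphi // !minkE; ring.
Qed.

Let phi_neq_on i j : edge_in D i j -> phi i != phi j.
Proof.
move=> /and3P[e Di Dj]; have [k _ [_ gij]] := dxg e.
apply: contra_neq gij => pij; rewrite -gam_mink // pij.
by rewrite mink_spin_null mulr0.
Qed.

Let edge_inC i j : edge_in D i j = edge_in D j i.
Proof. by rewrite /edge_in edgeC [D i && _]andbC. Qed.

Let labC i j : edge_in D i j -> lab i j = lab j i.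
Proof. by case/and3P => e _ _; apply: edge_label_sym. Qed.

Let lab0 i j : edge_in D i j -> lab i j != 0.
Proof. by case/and3P => e _ _; apply: edge_label_neq0. Qed.

Let lab1 i j : edge_in D i j -> lab i j != 1.
Proof. exact: edge_label_neq1. Qed.

Let sE i j : s i j ^+ 2 = (lab i j)%:C. Proof. exact: sqr_sqrtc. Qed.
Let rE i j : r i j ^+ 2 = (lab i j - 1)%:C. Proof. exact: sqr_sqrtc. Qed.

(** The motion by U preserves products, so [dx_label] carries over to the moved surface and
    [boost_edge] is read backwards. The factors [c] cancel because (y, gam) = 1 / c. *)
Let y_boost i j : edge_in D i j -> y i = boost (lab i j) 1 (gam i) (gam j) (y j).
Proof.
move=> e; have /and3P[e' Di Dj] := e; have ij := phi_neq_on e.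
have gij : mink (gam i) (gam j) != 0 by rewrite mink_spin_eq0 mulr1 mul1r.
apply/(boost_edge _ _ (lab0 e) (lab1 e) (mink_spin_null _ _) (mink_spin_null _ _) gij).
have alE n : D n -> mink (y n) (gam n) = (c n)^-1.
  move=> Dn; apply: (mulfI (c0 Dn)); rewrite divff ?c0 //.
  by rewrite -minkZr -gphi // mink_lorentz //; case: (gG n).
rewrite !alE // -linearB (dx_label gG dxg e') linearZ linearB /= !gphi //.
rewrite -gam_mink //; have [ci cj] := (c0 Di, c0 Dj).
move: (lab0 e) gij; move: (lab i j) (gam i) (gam j) => l u v l0 uv.
by apply/rowP => p; rewrite !mxE; field; rewrite ci cj l0 uv.
Qed.

Let cross_on i : face_in D i ->
  cross_ratio (phi i) (phi (vj i)) (phi (vk i)) (phi (vl i)) =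
    (lab i (vl i) / lab i (vj i))%:C /\ lab i (vl i) / lab i (vj i) < 0.
Proof.
move=> Df; have /and4P[Di Dj Dk Dl] := Df.
have [[[[ti tj] tk] tl] /= [[ti0 tj0 tk0 tl0] rel _ labE neg]] :=
  face_label gG dxg diag dimG reg Df.
split=> //; rewrite labE.
have e1 : edge_in D (vj i) (vk i) by rewrite /edge_in edge_jk Dj Dk.
have e2 : edge_in D (vl i) i by rewrite /edge_in edgeC edge_vl Dl Di.
have rel' : (ti * c i) *: gam i + (tk * c (vk i)) *: gam (vk i) =
            (tj * c (vj i)) *: gam (vj i) + (tl * c (vl i)) *: gam (vl i).
  by rewrite -!scalerA -!gphi // -!linearZ -!linearD rel.
rewrite (cross_ratio_gram rel') ?mulf_neq0 ?c0 ?phi_neq_on //.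
congr (- (_ / _))%:C; rewrite -[RHS](mink_lorentz _ _ dU) !linearZ /= !gphi // !scalerA //.
Qed.

Let label_face i : face_in D i ->
  lab i (vj i) = lab (vl i) (vk i) /\ lab i (vl i) = lab (vj i) (vk i).
Proof. by case/(face_label gG dxg diag dimG reg) => t []. Qed.

Let invB i j : edge_in D i j -> invmx (B i j) = B j i.
Proof.
move=> e; apply: (invmx_Bmx (phi_neq_on e) (lab0 e) (lab1 e) (sE i j) (rE i j) (labC e)).
  by rewrite /s labC.
by rewrite /r labC.
Qed.

Let detB i j : edge_in D i j -> \det (B i j) = 1.
Proof.
by move=> e; apply: (det_Bmx (phi_neq_on e) (lab0 e) (lab1 e) (sE i j) (rE i j)).
Qed.

Let unitB i j : edge_in D i j -> B i j \in unitmx.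
Proof. by move=> e; rewrite unitmxE detB ?unitr1. Qed.

Let invmx_square (A1 A2 A3 A4 P : 'M[C]_2) :
  A1 \in unitmx -> A2 \in unitmx -> A3 \in unitmx -> A4 \in unitmx ->
  A1 *m A2 = A3 *m A4 ->
  invmx A2 *m (invmx A1 *m P) = invmx A4 *m (invmx A3 *m P).
Proof.
have invM (A A' : 'M[C]_2) : A \in unitmx -> A' \in unitmx ->
    invmx A' *m invmx A = invmx (A *m A').
  move=> uA uA'; have uAA : A *m A' \in unitmx by rewrite unitmx_mul uA.
  by rewrite -[LHS](mulmxK uAA) -!mulmxA mulKmx // mulKmx.
by move=> u1 u2 u3 u4 e; rewrite !mulmxA !invM // e.
Qed.

(** Frame and sign are integrated as one pair, starting from a factorisation of [y o]. Around a face
    the frame closes by [Bmx_face] and the sign because opposite labels agree; the representation of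
    y spreads along edges by [Bmx_boost]. *)
Lemma weierstrass_data : exists (Phi : Z2 -> 'M[C]_2) (eps : Z2 -> R),
  weierstrass_on D mu phi lab 1 s r Phi eps (fun i => y i) (fun i => (lorentz U @: G i)%VS) /\
  (0 < mu -> eps o = 1).
Proof.
have yo0 : y o != 0.
  apply/eqP => yo; have [_ xg _] := gG o; have := mink_lorentz (x o) (g o) dU.
  by rewrite yo mink0l xg => /eqP; rewrite eq_sym oner_eq0.
have yy i : mink (y i) (y i) = mu by rewrite mink_lorentz.
have [Po [eo [dPo eo1 eomu yoE]]] := represented_herm (yy o) yo0.
pose sgl i j := Num.sg (lab i j * (lab i j - 1)).
have sgl2 i j : edge_in D i j -> sgl i j * sgl i j = 1.
  move=> e; rewrite /sgl -expr2 sqr_sg mulf_neq0 ?lab0 //.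
  by rewrite subr_eq0 lab1.
pose t i j (f : 'M[C]_2 * R) := (invmx (B i j) *m f.1, sgl i j * f.2).
have [F [Fo FE]] : exists F : Z2 -> 'M[C]_2 * R, F o = (Po, eo) /\
    forall i j, edge_in D i j -> F j = t i j (F i).
  apply: rect_integrate => // [i j [P e] eij|i [P e] Df].
    rewrite /t /= invB -1?edge_inC // mulKVmx ?unitB //.
    by rewrite {1}/sgl -(labC eij) -/(sgl i j) mulrA sgl2 // mul1r.
  have /and4P[Di Dj Dk Dl] := Df; have [l1 l2] := label_face Df.
  have eij : edge_in D i (vj i) by rewrite /edge_in edge_vj Di Dj.
  have eil : edge_in D i (vl i) by rewrite /edge_in edge_vl Di Dl.
  have ejk : edge_in D (vj i) (vk i) by rewrite /edge_in edge_jk Dj Dk.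
  have elk : edge_in D (vl i) (vk i) by rewrite /edge_in edge_lk Dl Dk.
  have [crE _] := cross_on Df.
  have faceE : B i (vj i) *m B (vj i) (vk i) = B i (vl i) *m B (vl i) (vk i).
    by apply: Bmx_face => //; rewrite /s /r ?l1 ?l2 // -?l1 -?l2 lab0.
  rewrite /t /= (invmx_square _ _ _ _ _ faceE) ?unitB //.
  by rewrite /sgl -l1 -l2 [X in (_, X)]mulrCA.
pose inv_at i := [/\ \det (F i).1 = 1, (F i).2 = 1 \/ (F i).2 = -1 &
    herm (y i) = (F i).2%:C *: ((F i).1 *m Dmx mu *m adj (F i).1)].
have inv : forall i, D i -> inv_at i.
  apply: (rect_ind Do) => [|i j e [d1 e1 yE]]; rewrite /inv_at; first by rewrite Fo.
  have e' : edge_in D j i by rewrite edge_inC.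
  rewrite (FE i j e) /t /= invB //; split.
  - by rewrite det_mulmx d1 mulr1 detB.
  - have := sgl2 i j e; rewrite -expr2 => /eqP; rewrite sqrf_eq1.
    by case/orP => /eqP->; case: e1 => ->; rewrite ?mulrNN ?mulr1 ?mul1r; [left|right|right|left].
  have := Bmx_boost (phi_neq_on e') (lab0 e') (lab1 e') (sE j i) (rE j i) (y i).
  rewrite -(y_boost e') -/(sgl j i).
  have -> : sgl j i = sgl i j by rewrite /sgl (labC e).
  move=> /(congr1 (fun A => (sgl i j)%:C *: A)); rewrite scalerA -rmorphM sgl2 // scale1r => <-.
  by rewrite yE -scalemxAr -scalemxAl scalerA -rmorphM cadjM !mulmxA.
exists (fun i => (F i).1), (fun i => (F i).2); split; last by rewrite Fo.
split.
- split; last by split; [exact: oner_neq0|move=> i j e; rewrite eq_sym lab1].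
  split=> [|i j e|i Df]; [|exact: lab0|exact: cross_on].
  by split; [exact: labC|exact: label_face].
- have ef (f : Z2 -> Z2 -> R) (h : R -> C) :
      (forall i j, f i j = lab i j) -> edge_function D (fun i j => h (f i j)).
    move=> fE; split=> [i j e|i Df]; rewrite !fE; first by rewrite labC.
    by have [-> ->] := label_face Df.
  split; [exact: (ef lab (fun l => sqrtc l%:C))|exact: (ef lab (fun l => sqrtc (l - 1)%:C))|].
  by move=> i j _; split; [exact: sE|exact: rE].
- split=> [i Di|i j e]; first by have [] := inv i Di.
  by rewrite (FE i j e).
- split=> [i Di|i j e]; first by have [] := inv i Di.
  rewrite (FE i j e) /= mulrCA; have /and3P[_ Di _] := e.
  by have [_ [] -> _] := inv i Di; rewrite ?mulrNN !mulr1.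
move=> i Di; split; first by have [] := inv i Di.
have [<- _ _] := gG i; rewrite limg_line gphi // vline_scale ?c0 //.
by rewrite unherm_Gmx.
Qed.

End Construction.

(** * Choice of the affine coordinate and conclusion *)

Lemma spin_affine (R : realType) (t : R) (a b : R[i]) (p q c d : R[i]) :
  t != 0 -> c * a + d * b != 0 ->
  exists zk : R[i] * R, zk.2 != 0 /\
    lorentz (mx22 p q c d) (t *: spin a b) = zk.2 *: spin zk.1 1.
Proof.
move=> t0 cd0; exists ((p * a + q * b) / (c * a + d * b), t * nsq (c * a + d * b)).
split; first by rewrite mulf_neq0 // gt_eqF // nsq_gt0.
rewrite linearZ /= lorentz_spin -scalerA -spinZ mulr1.
by have -> z k : k != 0 -> k * (z / k) = z :> R[i] by move=> k0; rewrite mulrC divfK.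
Qed.

Local Close Scope complex_scope.

Theorem theorem4p4 (R : realType) (mu : R) :
  (forall (phi : Z2 -> R[i]) (lab : Z2 -> Z2 -> R) (m : R)
          (s r : Z2 -> Z2 -> R[i]) (Phi : Z2 -> 'M[R[i]]_2) (eps : Z2 -> R)
          (x : Z2 -> 'rV[R]_4) (G : Z2 -> {vspace 'rV[R]_4}),
     weierstrass_on predT mu phi lab m s r Phi eps x G ->
     (forall i : Z2, ~ perp (x i) (G i)) ->
     ((forall i : Z2, mixed_area x x i != 0) ->
        (mu != 0 -> cmc mu x G) /\ (mu = 0 -> intrinsically_flat x G)) /\
     omega_dual x G)
  /\
  (forall (x : Z2 -> 'rV[R]_4) (G : Z2 -> {vspace 'rV[R]_4}),
     (mu != 0 /\ cmc mu x G) \/ (mu = 0 /\ intrinsically_flat x G) ->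
     forall (I J : interval int) (o : Z2),
       rect I J o -> regular_on (rect I J) x G ->
       exists U : 'M[R[i]]_2,
         [/\ \det U = 1,
             (forall i : Z2, rect I J i -> G i <> Ginfty R) -> U = 1%:M &
             exists (phi : Z2 -> R[i]) (lab : Z2 -> Z2 -> R) (m : R)
                    (s r : Z2 -> Z2 -> R[i]) (Phi : Z2 -> 'M[R[i]]_2)
                    (eps : Z2 -> R),
               weierstrass_on (rect I J) mu phi lab m s r Phi eps
                 (fun i => lorentz U (x i))
                 (fun i => (lorentz U @: G i)%VS) /\
               (0 < mu -> eps o = 1)]).
Proof.
split=> [phi lab m s r Phi eps x G W xG|x G H I J o Do reg].
  split=> [A0|]; last exact: weierstrass_omega_dual W xG.
  by split; [exact: weierstrass_cmc W xG A0|exact: weierstrass_flat W xG A0].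
have [Q [g0 [g0G par A0]]] := christoffel_gauss H.
have [g [gG dxg diag]] := normalized_gauss Q g0G par A0.
case: (Q) => xx _ [_ _ dimG] _ _.
have [v vE] : {v : Z2 -> R * R[i] * R[i] &
    forall i, g i = (v i).1.1 *: spin (v i).1.2 (v i).2}.
  apply: (@choice _ _ (fun i v => g i = v.1.1 *: spin v.1.2 v.2)) => i.
  have [_ _ gi] := gG i.
  by have [t [a [b gE]]] := null_scaled_spin gi; exists (t, a, b).
have g_neq0 i : g i != 0.
  apply/eqP => g0i; have [_ + _] := gG i; rewrite g0i mink0r => /eqP.
  by rewrite eq_sym oner_eq0.
have t0 i : (v i).1.1 != 0.
  by apply: contra_neq (g_neq0 i) => e; rewrite vE e scale0r.
(* If the second row of the matrix annihilates none of the spinors, the moved Gauss map avoids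
   infinity and has an affine coordinate. *)
have data p q c d : p * d - q * c = 1 ->
    (forall i, rect I J i -> c * (v i).1.2 + d * (v i).2 != 0) ->
    exists (phi : Z2 -> R[i]) (lab : Z2 -> Z2 -> R) (m : R)
           (s r : Z2 -> Z2 -> R[i]) (Phi : Z2 -> 'M[R[i]]_2) (eps : Z2 -> R),
      weierstrass_on (rect I J) mu phi lab m s r Phi eps
        (fun i => lorentz (mx22 p q c d) (x i))
        (fun i => (lorentz (mx22 p q c d) @: G i)%VS) /\ (0 < mu -> eps o = 1).
  move=> dU fin; have [zk zkE] : {zk : Z2 -> R[i] * R & forall i, rect I J i ->
      (zk i).2 != 0 /\ lorentz (mx22 p q c d) (g i) = (zk i).2 *: spin (zk i).1 1}.
    apply: (@choice _ _ (fun i zk => rect I J i -> zk.2 != 0 /\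
      lorentz (mx22 p q c d) (g i) = zk.2 *: spin zk.1 1)) => i.
    have [Di|nDi] := boolP (rect I J i); last by exists (0, 0).
    by rewrite vE; have [zk] := spin_affine p q (t0 i) (fin i Di); exists zk.
  have [|||Phi [eps W]] := weierstrass_data xx gG dxg diag dimG Do reg
    (U := mx22 p q c d) (phi := fun i => (zk i).1) (c := fun i => (zk i).2).
  - by rewrite det_mx22.
  - by move=> i Di; have [] := zkE i Di.
  - by move=> i Di; have [] := zkE i Di.
  by do 3 eexists; do 2 eexists; exists Phi, eps; exact: W.
have [fin|inf] := pselect (forall i, rect I J i -> G i <> Ginfty R).
  exists 1%:M; split=> //; first by rewrite det1.
  rewrite scalar_mx22; apply: data => [|i Di]; first by rewrite mulr1 mulr0 subr0.
  rewrite mul0r add0r mul1r; apply/eqP => b0; apply: (fin i Di).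
  have [<- _ _] := gG i; rewrite /Ginfty unherm_Ginfty.
  have := g_neq0 i; have := t0 i; rewrite vE b0 => ti ai.
  have e : spin (v i).1.2 0 = nsq (v i).1.2 *: spin 1 0 by rewrite -spinZ mulr1 mulr0.
  rewrite e scalerA vline_scale //.
  by apply: contra_neq ai => z; rewrite e scalerA z scale0r.
(* The row (t, 1) annihilates a nonzero spinor (a, b) only if t = - b / a. The lattice is countable,
   so some real t avoids all these values. *)
have [t tE] := countable_avoid (fun i => complex.Re (- (v i).2 / (v i).1.2)).
exists (mx22 1 0 t%:C%C 1); split=> [|/inf//|]; first by rewrite det_mx22 mulr1 mul0r subr0.
apply: data => [|i _]; first by rewrite mulr1 mul0r subr0.
rewrite mul1r; apply/eqP => e.
have bE : (v i).2 = - (t%:C%C * (v i).1.2) by apply/eqP; rewrite -addr_eq0 addrC e.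
have [a0|a0] := eqVneq (v i).1.2 0.
  have := g_neq0 i; rewrite vE scaler_eq0 negb_or -spin_neq0 bE a0 mulr0 oppr0 eqxx.
  by rewrite andbF.
by have := tE i; rewrite bE opprK mulfK //= eqxx.
Qed.
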